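(* Let $n\ge 2$ and let $C_1,\dots,C_n\subset\mathbb{P}^2$ be pairwise distinct nonsingular plane curves of degree $2$ over $k$. Let $\hat{C}_i\subset\hat{\mathbb{P}}^2$ be the dual curve of $C_i$ ($i=1,\dots,n$), and let $$\mathcal{L}(\hat{C}_1,\ldots,\hat{C}_n)=\Big\{\overline{pq}\subset\hat{\mathbb{P}}^2 \;\Big|\; p,q\in\bigcap_{i=1}^n\hat{C}_i,\ p\ne q\Big\},$$ where $\overline{pq}$ is the line passing through $p$ and $q$. Then the map $$\Phi:\mathcal{L}(\hat{C}_1,\dots,\hat{C}_n)\to S\Delta_{\mathrm{out}}(C_1,\dots,C_n)$$ sending the line $aX+bY+cZ=0$ in $\hat{\mathbb{P}}^2$ to the point $(a:b:c)\in\mathbb{P}^2$ is (well defined and) a bijection. In particular, with $m=\#\bigcap_{i=1}^n\hat{C}_i$, $$\#S\Delta_{\mathrm{out}}(C_1,\ldots,C_n)=\begin{cases}0,&\text{if } m=0,1,\\ 1,&\text{if } m=2,\\ 3,&\text{if } m=3,\\ 6,&\text{if } m=4.\end{cases}$$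
   Context: $k$ is an algebraically closed field of characteristic $0$, and $\mathbb{P}^2$ is the projective plane over $k$. $\hat{\mathbb{P}}^2$ is the dual projective plane, whose point $(a:b:c)$ corresponds to the line $aX+bY+cZ=0$ in $\mathbb{P}^2$; the dual curve $\hat{C}\subset\hat{\mathbb{P}}^2$ of a nonsingular plane curve $C$ is the closure of the set of points corresponding to the tangent lines of $C$. For $P\in\mathbb{P}^2$, $\pi_P$ denotes the projection from $P$ to $\mathbb{P}^1$, and for a plane curve $C_i$ (not a line through $P$) $\pi_P^*k(\mathbb{P}^1)\subset k(C_i)$ is the subfield of the function field obtained by pulling back along $\pi_P|_{C_i}$. A point $P\in\mathbb{P}^2$ is a simultaneous Galois point (SG point) for a reduced plane curve $C=\bigcup_{i=1}^nC_i$ with irreducible components $C_i$ if every field extension $k(C_i)/\pi_P^*k(\mathbb{P}^1)$ ($i=1,\dots,n$) is Galois and $k(C_i)\simeq k(C_j)$ as $\pi_P^*k(\mathbb{P}^1)$-algebras (that is, as extensions of $k(\mathbb{P}^1)$ via $\pi_P^*$) for all $1\le i,j\le n$. An SG point $P$ is outer if $P\notin\bigcup_{i=1}^nC_i$. $S\Delta_{\mathrm{out}}(C_1,\dots,C_n)$ denotes the set of all outer SG points for $C=\bigcup_{i=1}^n C_i$. *)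

(* Defs.v *)
From HB Require Import structures.
From mathcomp Require Import all_boot all_order all_algebra all_field.
From mathcomp Require Import boolp classical_sets functions cardinality.
From mathcomp.multinomials Require Import mpoly.

Set Implicit Arguments.
Unset Strict Implicit.
Unset Printing Implicit Defensive.

Import GRing.Theory.
Local Open Scope ring_scope.
Local Open Scope quotient_scope.

Local Notation "x %:F" := (tofrac x).

Section ProjectivePlane.
Variable k : closedFieldType.

(* d-dimensional linear subspaces of k^3; the dual space is identified with
   k^3 through coordinates, so these types also serve for the dual plane. *)
Definition subsp (d : nat) := {U : {vspace 'rV[k]_3} | \dim U == d}.
Definition point := subsp 1.
Definition line := subsp 2.

Definition pairing (a x : 'rV[k]_3) : k := \sum_(i < 3) a 0 i * x 0 i.

Definition orth (U : {vspace 'rV[k]_3}) : {vspace 'rV[k]_3} :=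
  lker (linfun (mulmxr (\matrix_(i < \dim U) (vbasis U)`_i)^T)).

Lemma mem_orth (U : {vspace 'rV[k]_3}) (a : 'rV[k]_3) :
  (a \in orth U) = `[< forall x, x \in U -> pairing a x = 0 >].
Proof.
rewrite memv_ker lfunE /=.
set M := (\matrix_i _)^T.
have aM i : (a *m M) 0 i = pairing a (vbasis U)`_i.
  by rewrite mxE; apply: eq_bigr => j _; rewrite !mxE.
apply/eqP/asboolP => [aM0 x xU|aU].
  rewrite (coord_vbasis xU) /pairing.
  under eq_bigr do rewrite summxE mulr_sumr.
  rewrite exchange_big big1 // => i _.
  under eq_bigr do rewrite mxE mulrCA.
  by rewrite -mulr_sumr -[X in _ * X]/(pairing _ _) -aM aM0 mxE mulr0.
apply/rowP => i; rewrite aM mxE; apply: aU.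
by apply: vbasis_mem; rewrite mem_nth ?size_tuple.
Qed.

Lemma dim_orth (U : {vspace 'rV[k]_3}) : \dim (orth U) = (3 - \dim U)%N.
Proof.
rewrite /orth; set M := (\matrix_i _).
have Mfree : row_free M.
  apply/inj_row_free => v vM0; apply/rowP => i; rewrite mxE.
  have /freeP := basis_free (vbasisP U); apply=> //.
  rewrite -[RHS]vM0 mulmx_sum_row; apply: eq_bigr => j _.
  by rewrite rowK.
have full : limg (linfun (mulmxr M^T) : 'Hom('rV[k]_3, 'rV[k]_(\dim U)))
              = fullv.
  apply/vspaceP => y; rewrite memvf; apply/memv_imgP.
  have : (y <= M^T)%MS by rewrite submx_full // /row_full mxrank_tr.
  by case/submxP => a ->; exists a; rewrite ?memvf // lfunE.
have := limg_ker_dim (linfun (mulmxr M^T) : 'Hom('rV[k]_3, 'rV[k]_(\dim U)))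
          fullv.
have e (m : nat) : (1%N * m)%R = m by exact: mul1n.
by rewrite full capfv !dimvf !dim_matrix !e => /(canRL (addnK _)).
Qed.

Fact coef_point_subproof (L : line) : \dim (orth (val L)) == 1%N.
Proof. by rewrite dim_orth (eqP (valP L)). Qed.

(* (a : b : c) for the line L : aX + bY + cZ = 0 *)
Definition coef_point (L : line) : point :=
  exist _ (orth (val L)) (coef_point_subproof L).

Lemma mem_coef_point (L : line) (a : 'rV[k]_3) :
  a \in val (coef_point L) <-> forall x, x \in val L -> pairing a x = 0.
Proof. by rewrite mem_orth; split=> /asboolP. Qed.

Definition vanishes (G : {mpoly k[3]}) (P : point) : Prop :=
  forall v, v \in val P -> G.@[v 0] = 0.

Definition zero_locus (G : {mpoly k[3]}) : set point :=
  [set P | vanishes G P].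

Definition gradient (G : {mpoly k[3]}) (v : 'rV[k]_3) : 'rV[k]_3 :=
  \row_i (G^`M(i)).@[v 0].

(* The zero polynomial is d.-homog for every d, hence the first conjunct. *)
Definition curve_equation (d : nat) (F : {mpoly k[3]}) : Prop :=
  F != 0 /\ F \is d.-homog.

Definition nonsingular (F : {mpoly k[3]}) : Prop :=
  forall v : 'rV[k]_3, v != 0 -> F.@[v 0] = 0 -> gradient F v != 0.

(* Since \dim T = 1, only points with nonzero gradient contribute. *)
Definition tangent_lines (F : {mpoly k[3]}) : set point :=
  [set T | exists2 P : point, vanishes F P &
     exists2 v : 'rV[k]_3, v \in val P & val T = <[gradient F v]>%VS].

Definition zariski_closure (A : set point) : set point :=
  [set Q | forall d (G : {mpoly k[3]}), G \is d.-homog ->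
     (forall P : point, A P -> vanishes G P) -> vanishes G Q].

Definition dual_curve (F : {mpoly k[3]}) : set point :=
  zariski_closure (tangent_lines F).

Definition common_tangents n (F : 'I_n -> {mpoly k[3]}) : set point :=
  [set T | forall i, dual_curve (F i) T].

Definition secant_lines n (F : 'I_n -> {mpoly k[3]}) : set line :=
  [set L | exists p q : point, [/\ common_tangents F p, common_tangents F q,
                          p != q & val L = (val p + val q)%VS]].

End ProjectivePlane.

(* Degree-zero part of the homogeneous field of fractions of a graded domain R,
   with grading induced by a morphism p : k[X, Y, Z] -> R. *)
Section HomogeneousFractions.
Variables (k : closedFieldType) (R : idomainType).
Variable p : {rmorphism {mpoly k[3]} -> R}.

Definition ratio_of (G H : {mpoly k[3]}) : {fraction R} := (p G)%:F / (p H)%:F.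

Definition degree_zero : pred {fraction R} := fun z =>
  `[< exists d G H, [/\ G \is d.-homog, H \is d.-homog,
        p H != 0 & z = ratio_of G H] >].

Lemma degree_zero_closed : divring_closed degree_zero.
Proof.
split.
- apply/asboolP; exists 0%N, 1, 1; split; rewrite ?dhomog1 ?rmorph1 ?oner_eq0 //.
  by rewrite /ratio_of !rmorph1 divr1.
- move=> z1 z2 /asboolP[d1 [G1 [H1 [hG1 hH1 nH1 ->]]]].
  move=> /asboolP[d2 [G2 [H2 [hG2 hH2 nH2 ->]]]]; apply/asboolP.
  exists (d1 + d2)%N, (G1 * H2 - G2 * H1), (H1 * H2); split.
  + apply: rpredB; first exact: dhomogM.
    by rewrite addnC; exact: dhomogM.
  + exact: dhomogM.
  + by rewrite rmorphM mulf_neq0.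
  rewrite /ratio_of rmorphB !rmorphM /= tofracB !tofracM.
  rewrite -mulNr addf_div ?tofrac_eq0 //.
  by rewrite mulNr.
- move=> z1 z2 /asboolP[d1 [G1 [H1 [hG1 hH1 nH1 ->]]]].
  move=> /asboolP[d2 [G2 [H2 [hG2 hH2 nH2 ->]]]]; apply/asboolP.
  have [G20|G2N] := eqVneq (p G2) 0.
    exists 0%N, 0, 1; split; rewrite ?dhomog0 ?dhomog1 ?rmorph1 ?oner_eq0 //.
    by rewrite /ratio_of G20 !rmorph0 !mul0r invr0 mulr0.
  exists (d1 + d2)%N, (G1 * H2), (H1 * G2); split; rewrite ?dhomogM //.
    by rewrite rmorphM mulf_neq0.
  by rewrite /ratio_of !rmorphM /= invf_div mulf_div.
Qed.

HB.instance Definition _ :=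
  GRing.isDivringClosed.Build {fraction R} degree_zero degree_zero_closed.

Record homog_frac := HomogFrac {
  homog_frac_val :> {fraction R};
  _ : homog_frac_val \in degree_zero
}.

HB.instance Definition _ := [isSub for homog_frac_val].
HB.instance Definition _ := [Choice of homog_frac by <:].
HB.instance Definition _ := [SubChoice_isSubComUnitRing of homog_frac by <:].
HB.instance Definition _ :=
  [SubComUnitRing_isSubIntegralDomain of homog_frac by <:].

(* Replaces [SubIntegralDomain_isSubField of homog_frac by <:], whose conversion
   check takes minutes. *)
Lemma homog_frac_fieldP : GRing.field_axiom homog_frac.
Proof.
move=> u u0; have vu0 : val u != 0.
  by apply: contraNneq u0 => v0; apply/eqP/val_inj; rewrite v0 GRing.val0.
have vuV : (val u)^-1 \in degree_zero by rewrite rpredV; exact: valP.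
apply/unitrPr; exists (HomogFrac vuV); apply: val_inj.
by rewrite GRing.valM GRing.val1 /= divff.
Qed.

HB.instance Definition _ := GRing.UnitRing_isField.Build homog_frac
  homog_frac_fieldP.

End HomogeneousFractions.

Section FunctionField.
Variable k : closedFieldType.

Definition mdvd (F G : {mpoly k[3]}) : Prop := exists Q, G = Q * F.

Record irr_curve := IrrCurve {
  form : {mpoly k[3]};
  form_neq0 : form != 0;
  form_homog : exists d, form \is d.-homog;
  form_proper : ~ mdvd form 1;
  form_prime : forall G H, mdvd form (G * H) -> mdvd form G \/ mdvd form H
}.

Variable C : irr_curve.

Definition curve_ideal : pred {mpoly k[3]} := fun G => `[< mdvd (form C) G >].

Lemma curve_ideal_closed : idealr_closed curve_ideal.
Proof.
split; first by apply/asboolP; exists 0; rewrite mul0r.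
  by apply/asboolP; exact: form_proper.
move=> a u v /asboolP[p ->] /asboolP[q ->]; apply/asboolP.
by exists (a * p + q); rewrite mulrDl mulrA.
Qed.

HB.instance Definition _ :=
  isIdealr.Build {mpoly k[3]} curve_ideal curve_ideal_closed.

Lemma curve_ideal_prime : prime_idealr_closed curve_ideal.
Proof.
move=> u v /asboolP/form_prime uv; apply/orP.
by case: uv => ?; [left|right]; apply/asboolP.
Qed.

HB.instance Definition _ :=
  isPrimeIdealrClosed.Build {mpoly k[3]} curve_ideal curve_ideal_prime.

Definition coord_ring := {ideal_quot (curve_ideal : prime_idealr {mpoly k[3]})}.

HB.instance Definition _ := GRing.ComNzRing.on coord_ring.

Definition coord_pi (G : {mpoly k[3]}) : coord_ring :=
  \pi_{ideal_quot (curve_ideal : prime_idealr {mpoly k[3]})} G.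

HB.instance Definition _ := GRing.RMorphism.copy coord_pi
  \pi_{ideal_quot (curve_ideal : prime_idealr {mpoly k[3]})}.

Definition coord_unit : pred coord_ring := fun x => `[< exists y, y * x = 1 >].
Definition coord_inv (x : coord_ring) : coord_ring :=
  if pselect (exists y, y * x = 1) is left h then projT1 (cid h) else x.

Fact coord_mulVx : {in coord_unit, left_inverse 1 coord_inv *%R}.
Proof.
move=> x /asboolP xU; rewrite /coord_inv; case: pselect => // h.
by case: cid.
Qed.

Fact coord_unitP (x y : coord_ring) : y * x = 1 -> coord_unit x.
Proof. by move=> yx; apply/asboolP; exists y. Qed.

Fact coord_inv_out : {in [predC coord_unit], coord_inv =1 id}.
Proof.
move=> x /negP xU; rewrite /coord_inv; case: pselect => // h.
by case: xU; apply/asboolP.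
Qed.

HB.instance Definition _ := GRing.ComNzRing_hasMulInverse.Build coord_ring
  coord_mulVx coord_unitP coord_inv_out.

HB.instance Definition _ := GRing.ComUnitRing_isIntegral.Build coord_ring
  (@Quotient.rquot_IdomainAxiom _ curve_ideal).

Lemma coord_pi_eq0 G : (coord_pi G == 0) = `[< mdvd (form C) G >].
Proof.
rewrite -[LHS]/(_ == 0 :>
  {ideal_quot (curve_ideal : prime_idealr {mpoly k[3]})}).
by rewrite piE Quotient.equivE subr0.
Qed.

Definition funfield := homog_frac coord_pi.

End FunctionField.

Section GaloisPoints.

(* [galois] applies to splittingFieldType structures only, so f : K -> L is
   compared with one through a K-isomorphism; in particular L is finite over
   f(K). *)
Definition galois_extension (K L : fieldType) (f : {rmorphism K -> L}) : Prop :=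
  exists (E : splittingFieldType K) (g : {rmorphism E -> L}),
    [/\ bijective g, forall x : K, g x%:A = f x & galois 1 {:E}].

Definition isom_extensions (K L M : fieldType)
    (f : {rmorphism K -> L}) (g : {rmorphism K -> M}) : Prop :=
  exists2 h : {rmorphism L -> M}, bijective h & forall x, h (f x) = g x.

Variable k : closedFieldType.

Definition linform (l : 'rV[k]_3) : {mpoly k[3]} := \sum_(i < 3) l 0 i *: 'X_i.

(* (linform l1 : linform l2) : P^2 --> P^1 is a projection from P; it is unique
   up to an automorphism of P^1. *)
Definition projection_from (P : point k) (l1 l2 : 'rV[k]_3) : Prop :=
  free [:: l1; l2] /\
  forall v, v \in val P -> pairing l1 v = 0 /\ pairing l2 v = 0.

(* phi is the pullback k(P^1) = k(t) -> k(C) along (l1 : l2), that is, the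
   k-morphism with t |-> l1 / l2; it exists only if l1 / l2 is nonconstant
   on C. *)
Definition is_pullback (C : irr_curve k) (l1 l2 : 'rV[k]_3)
    (phi : {rmorphism {fraction {poly k}} -> funfield C}) : Prop :=
  (forall c : k, val (phi (c%:P)%:F) = ratio_of (@coord_pi k C) c%:MP 1) /\
  val (phi ('X)%:F) = ratio_of (@coord_pi k C) (linform l1) (linform l2).

(* The curves F i = 0 are the components of C, so their irreducibility is
   part of the notion. *)
Definition sg_point n (F : 'I_n -> {mpoly k[3]}) (P : point k) : Prop :=
  exists C : 'I_n -> irr_curve k, (forall i, form (C i) = F i) /\
  forall l1 l2, projection_from P l1 l2 ->
  exists phi : forall i, {rmorphism {fraction {poly k}} -> funfield (C i)},
    [/\ forall i, is_pullback l1 l2 (phi i),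
        forall i, galois_extension (phi i)
      & forall i j, isom_extensions (phi i) (phi j)].

Definition outer_sg_points n (F : 'I_n -> {mpoly k[3]}) : set (point k) :=
  [set P | sg_point F P /\ forall i, ~ vanishes (F i) P].

End GaloisPoints.

(* Main.v *)
(* Write the conic C_i as v A_i v^T = 0 and let B_i be the inverse of A_i, so that
   the dual curve of C_i is w B_i w^T = 0.  Let P = <p> lie outside C_i, let
   l1, l2 span the lines through P, and let l3 = p A_i be the polar of P.  The
   equation of C_i becomes c l3^2 + D_i(l1, l2) = 0, whence k(C_i) = k(t)(y) with
   t = l1 / l2 and y^2 a constant multiple of D_i(t, 1).  This quadratic extension
   is Galois, and two of them are isomorphic iff the D_i agree up to a constant
   and a square; as the roots of D_i are the tangent lines of C_i through P, this
   means that the C_i share both tangent lines through P.  So P is an outer SG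
   point iff its dual line joins two points common to all dual conics.  No three
   of these points are collinear, and there are at most four of them since five
   would determine the dual conic. *)
Require Import Defs.
From mathcomp Require Import all_boot all_order all_algebra all_field.
From mathcomp Require Import boolp classical_sets functions cardinality.
From mathcomp.multinomials Require Import mpoly.
From HB Require Import structures.
From mathcomp Require Import ring.

Set Implicit Arguments.
Unset Strict Implicit.
Unset Printing Implicit Defensive.
Import GRing.Theory.

Local Open Scope card_scope.
Local Open Scope ring_scope.

(** * Fraction fields and quadratic extensions *)

(** Isomorphism of the extensions is decided by the class of y^2 modulo squares in k(t). Constants
    are squares, so only zeros of odd order matter, and infinity is seen through the parity of the
    degree. The proof depends on a choice of coordinates on the pencil of lines through P. To show
    that P is an SG point, arbitrary l1, l2 are written in the basis w1, w2 of common tangents: l1 =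
    a1 w1 + b1 w2 and l2 = a2 w1 + b2 w2. Then D_i is a constant times (a2 t - a1)(b2 t - b1), the
    same for all i. To analyse an SG point, l1 and l2 are taken to be the two tangents of one
    reference conic, whose D is then a constant times t. For every i the product t D_i must be a
    square, so the constant coefficient of D_i and its coefficient of t^2 vanish; these are the
    values of the dual form at l1 and l2. The first direction must also produce the components as
    prime forms and the embeddings of k(t). Both rest on the parametrization of a conic by (s^2 :
    r^2 : s r): it embeds the coordinate ring in a polynomial ring and shows that no linear form
    vanishes on the conic. *)

Lemma fracP (R : idomainType) (x : {fraction R}) :
  exists n d, d != 0 /\ x = tofrac n / tofrac d.
Proof.
elim/quotW: x => x.
exists (frac x).1, (frac x).2; split; first exact: denom_ratioP.
apply: (canRL (mulfK _)); first by rewrite tofrac_eq0 denom_ratioP.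
rewrite /tofrac; unlock FracField.tofrac.
rewrite -[X in X = _]/(FracField.mul _ _) !piE.
apply/eqP; rewrite FracField.equivf_def /FracField.mulf /=.
by rewrite !numden_Ratio ?mulr1 ?oner_eq0 ?denom_ratioP // mulrC.
Qed.

(** The quotient [f n / f d] does not depend on the representation of a fraction, so choosing a
    value that serves all representations gives a function, and the morphism laws follow from those
    for fractions. *)
Lemma frac_extend (R : idomainType) (L : fieldType) (f : {rmorphism R -> L}) :
  (forall x, f x = 0 -> x = 0) ->
  exists g : {rmorphism {fraction R} -> L}, forall x, g (tofrac x) = f x.
Proof.
move=> finj.
have fN0 d : d != 0 -> f d != 0 by apply: contraNneq => /finj->.
have ex (x : {fraction R}) : exists y, forall n d, d != 0 ->
    x = tofrac n / tofrac d -> y = f n / f d.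
  have [n [d [d0 ->]]] := fracP x; exists (f n / f d) => n' d' d'0.
  move/eqP; rewrite eqr_div ?tofrac_eq0 // -!tofracM tofrac_eq => /eqP e.
  by apply/eqP; rewrite eqr_div ?fN0 // -!rmorphM e.
pose g x := projT1 (cid (ex x)).
have gE n d : d != 0 -> g (tofrac n / tofrac d) = f n / f d.
  by move=> d0; rewrite /g; case: cid => y /= /(_ n d d0 erefl).
have gF n : g (tofrac n) = f n.
  by have := @gE n 1; rewrite tofrac1 rmorph1 !divr1 oner_eq0 => ->.
have gB : zmod_morphism g.
  move=> x y; have [n [d [d0 ->]]] := fracP x; have [n' [d' [d'0 ->]]] := fracP y.
  rewrite -mulNr addf_div ?tofrac_eq0 // -tofracN -!tofracM -tofracD.
  rewrite !gE ?mulf_neq0 // -mulNr addf_div ?fN0 //.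
  by rewrite !(rmorphD, rmorphM, rmorphN).
have gM : monoid_morphism g.
  split; first by rewrite -tofrac1 gF rmorph1.
  move=> x y; have [n [d [d0 ->]]] := fracP x; have [n' [d' [d'0 ->]]] := fracP y.
  rewrite mulf_div -!tofracM !gE ?mulf_neq0 // !rmorphM.
  by rewrite mulf_div.
pose zM := GRing.isZmodMorphism.Build _ _ g gB.
pose mM := GRing.isMonoidMorphism.Build _ _ g gM.
pose G : {rmorphism {fraction R} -> L} := HB.pack g zM mM.
by exists G.
Qed.

Section QuadraticExtensions.
Variable K : fieldType.

Definition quad_span (L : fieldType) (phi : {rmorphism K -> L}) (y x : L) :=
  exists a b, x = phi a + phi b * y.

(** The last clause makes 1 and y independent over the image of phi, so L has degree exactly two. *)
Definition quad_gen (L : fieldType) (phi : {rmorphism K -> L}) (d : K) (y : L) :=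
  [/\ y ^+ 2 = phi d, forall x, quad_span phi y x
    & forall a, phi a <> y].

Section QuadSpan.
Variables (L : fieldType) (phi : {rmorphism K -> L}) (d : K) (y : L).
Hypothesis y2 : y ^+ 2 = phi d.
Local Notation S := (quad_span phi y).

Lemma quad_span_base a : S (phi a).
Proof. by exists a, 0; rewrite rmorph0 mul0r addr0. Qed.

Lemma quad_span0 : S 0.
Proof. by rewrite -(rmorph0 phi); exact: quad_span_base. Qed.

Lemma quad_span1 : S 1.
Proof. by rewrite -(rmorph1 phi); exact: quad_span_base. Qed.

Lemma quad_spanD x x' : S x -> S x' -> S (x + x').
Proof.
move=> [a [b ->]] [a' [b' ->]]; exists (a + a'), (b + b').
by rewrite !rmorphD; ring.
Qed.

Lemma quad_spanM x x' : S x -> S x' -> S (x * x').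
Proof.
move=> [a [b ->]] [a' [b' ->]]; exists (a * a' + b * b' * d), (a * b' + b * a').
by rewrite !(rmorphD, rmorphM) -y2; ring.
Qed.

(** The inverse is the conjugate over the norm a^2 - b^2 d. Since y may lie in the image of phi, the
    norm can vanish at a nonzero element; its conjugate is then 0, and the element itself is in the
    image of phi. *)
Lemma quad_spanV x : S x -> S x^-1.
Proof.
move=> [a [b ->]].
have [N0|N0] := eqVneq (a ^+ 2 - b ^+ 2 * d) 0; last first.
  exists (a / (a ^+ 2 - b ^+ 2 * d)), (- b / (a ^+ 2 - b ^+ 2 * d)).
  have N0' : phi a ^+ 2 - phi b ^+ 2 * y ^+ 2 != 0.
    by rewrite y2 -!rmorphXn -rmorphM -rmorphB fmorph_eq0.
  have s0 : phi a + phi b * y != 0.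
    apply: contraNneq N0' => /eqP; rewrite addr_eq0 => /eqP->.
    by rewrite sqrrN exprMn subrr.
  rewrite !fmorph_div rmorphB rmorphN !expr2 !rmorphM -y2 -!expr2.
  by field; rewrite exprMn N0' s0.
have : (phi a + phi b * y) * (phi a - phi b * y) = 0.
  transitivity (phi (a ^+ 2 - b ^+ 2 * d)); last by rewrite N0 rmorph0.
  by rewrite rmorphB !expr2 !rmorphM -y2; ring.
move/eqP; rewrite mulf_eq0 => /orP[/eqP->|].
  by rewrite invr0; exact: quad_span0.
by rewrite subr_eq0 => /eqP <-; rewrite -rmorphD -fmorphV; exact: quad_span_base.
Qed.

End QuadSpan.

(** Removes a square factor from d, so that extensions that differ by such a factor get literally
    the same d. *)
Lemma quad_gen_scale (L : fieldType) (phi : {rmorphism K -> L}) d e y :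
  e != 0 -> y ^+ 2 = phi (e ^+ 2 * d) -> (forall x, quad_span phi y x) ->
  (forall r, r ^+ 2 <> d) -> quad_gen phi d (y / phi e).
Proof.
move=> e0 y2 gen nsq; have pe0 : phi e != 0 by rewrite fmorph_eq0.
have y2' : (y / phi e) ^+ 2 = phi d.
  by rewrite expr_div_n y2 rmorphM !expr2 rmorphM mulrC mulKf // mulf_neq0.
split=> // [x|a aE].
  have [a [b ->]] := gen x; exists a, (b * e).
  by rewrite rmorphM; field.
by apply: (nsq a); apply: (fmorph_inj phi); rewrite expr2 rmorphM -expr2 aE.
Qed.

(** Write e = u + v y, so that e^2 = u^2 + v^2 d + 2 u v y. If u v is nonzero then y, and with it e,
    lies in the image of phi and t is a square; the same happens if v = 0. Hence u = 0 and t = v^2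
    d. *)
Lemma quad_square_class (L : fieldType) (phi : {rmorphism K -> L}) d y t e :
  2%:R != 0 :> K -> y ^+ 2 = phi d -> quad_span phi y e -> e ^+ 2 = phi t ->
  (forall r, r ^+ 2 <> t) -> exists v, v ^+ 2 * d = t.
Proof.
move=> two0 y2 [u [v eE]] e2 nsq.
have sq r : phi r <> e.
  by move=> rE; apply: (nsq r); apply: (fmorph_inj phi); rewrite expr2 rmorphM -expr2 rE.
have v0 : v != 0.
  by apply/eqP => v0; apply: (sq u); rewrite eE v0 rmorph0 mul0r addr0.
have pv0 : phi v != 0 by rewrite fmorph_eq0.
have p2 : 2%:R != 0 :> L by rewrite -(rmorph_nat phi) fmorph_eq0.
have [u0|u0] := eqVneq u 0.
  exists v; apply: (fmorph_inj phi).
  by rewrite -e2 eE u0 rmorph0 add0r exprMn y2 !expr2 !rmorphM.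
pose s := (t - u ^+ 2 - v ^+ 2 * d) / (2%:R * u * v).
have yE : y = phi s.
  have pu0 : phi u != 0 by rewrite fmorph_eq0.
  rewrite /s fmorph_div !rmorphB !expr2 !rmorphM -e2 -y2 eE rmorph_nat.
  by field; rewrite p2 pu0 pv0.
by case: (sq (u + v * s)); rewrite eE yE rmorphD rmorphM.
Qed.


Lemma quad_uniq (L : fieldType) (phi : {rmorphism K -> L}) d y a b a' b' :
  quad_gen phi d y -> phi a + phi b * y = phi a' + phi b' * y -> a = a' /\ b = b'.
Proof.
move=> [_ _ nK] e; suff bb : b = b'.
  by split=> //; move: e; rewrite bb => /addIr/fmorph_inj.
apply/eqP; rewrite -subr_eq0; apply/negPn/negP => bb.
apply: (nK ((a' - a) / (b - b'))).
have {}e : phi a' - phi a = (phi b - phi b') * y.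
  by rewrite -[phi a'](addrK (phi b' * y)) -e; ring.
rewrite fmorph_div !rmorphB e mulrC mulKf //.
by rewrite -rmorphB fmorph_eq0.
Qed.

Lemma quad_nonsquare (L : fieldType) (phi : {rmorphism K -> L}) d y e :
  quad_gen phi d y -> e ^+ 2 <> d.
Proof.
move=> [y2 _ nK] ed; move/eqP: y2; rewrite -ed rmorphXn eqf_sqr => /orP[]/eqP yE.
  exact: (nK e).
by apply: (nK (- e)); rewrite rmorphN yE.
Qed.

Lemma quad_hom (L M : fieldType) (phi : {rmorphism K -> L})
    (psi : {rmorphism K -> M}) d y z :
  quad_gen phi d y -> psi d = z ^+ 2 ->
  exists h : {rmorphism L -> M},
    forall a b, h (phi a + phi b * y) = psi a + psi b * z.
Proof.
move=> qL z2; have [y2 gL nL] := qL.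
have ex x : exists ab : K * K, x = phi ab.1 + phi ab.2 * y.
  by have [a [b ->]] := gL x; exists (a, b).
pose c x := projT1 (cid (ex x)).
have cE a b : c (phi a + phi b * y) = (a, b).
  rewrite /c; case: cid => [[a' b']] /= e.
  by have [-> ->] := quad_uniq qL e.
pose h x := psi (c x).1 + psi (c x).2 * z.
have hE a b : h (phi a + phi b * y) = psi a + psi b * z by rewrite /h cE.
have hphi a : h (phi a) = psi a.
  by have := hE a 0; rewrite !rmorph0 !mul0r !addr0.
have hB : zmod_morphism h.
  move=> u v; have [a [b ->]] := gL u; have [a' [b' ->]] := gL v.
  rewrite [X in h X](_ : _ = phi (a - a') + phi (b - b') * y).
    by rewrite !hE !rmorphB; ring.
  by rewrite !rmorphB; ring.
have hM : monoid_morphism h.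
  split; first by rewrite -(rmorph1 phi) hphi rmorph1.
  move=> u v; have [a [b ->]] := gL u; have [a' [b' ->]] := gL v.
  rewrite [X in h X](_ : _ = phi (a * a' + b * b' * d) + phi (a * b' + b * a') * y).
    by rewrite !hE !(rmorphD, rmorphM) z2; ring.
  by rewrite !(rmorphD, rmorphM) -y2; ring.
pose zM := GRing.isZmodMorphism.Build _ _ h hB.
pose mM := GRing.isMonoidMorphism.Build _ _ h hM.
pose H : {rmorphism L -> M} := HB.pack h zM mM.
by exists H.
Qed.

Lemma quad_isom (L M : fieldType) (phi : {rmorphism K -> L})
    (psi : {rmorphism K -> M}) d y z :
  quad_gen phi d y -> quad_gen psi d z -> isom_extensions phi psi.
Proof.
move=> qL qM; have [y2 gL _] := qL; have [z2 gM _] := qM.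
have [h hE] := quad_hom qL (esym z2); have [g gE] := quad_hom qM (esym y2).
exists h => [|a]; last by have := hE a 0; rewrite !rmorph0 !mul0r !addr0.
exists g => [x|x]; first by have [a [b ->]] := gL x; rewrite hE gE.
by have [a [b ->]] := gM x; rewrite gE hE.
Qed.

(** A model E of the extension is built by adjoining a root z of X^2 - d. It is a splitting field,
    the roots being z and -z, and [quad_isom] identifies it with L. *)
Lemma quad_galois (L : fieldType) (phi : {rmorphism K -> L}) d y :
  2%:R != 0 :> K -> quad_gen phi d y -> galois_extension phi.
Proof.
move=> two0 qL; have nsq e := @quad_nonsquare _ _ _ _ e qL.
have sz : size ('X^2 - d%:P : {poly K}) = 3%N by rewrite size_XnsubC.
have irr : irreducible_poly ('X^2 - d%:P : {poly K}).
  apply: cubic_irreducible => [|e]; first by rewrite sz.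
  by rewrite rootE !hornerE subr_eq0; apply/negP => /eqP; exact: nsq.
have [E dimE [z rz zE]] := irredp_FAdjoin irr.
have z2 : z ^+ 2 = in_alg E d.
  move: rz; rewrite rmorphB /= map_polyXn map_polyC rootE !hornerE subr_eq0.
  by move/eqP.
have p1 : map_poly (in_alg E) ('X^2 - d%:P) = \prod_(x <- [:: z; - z]) ('X - x%:P).
  rewrite !big_cons big_nil mulr1 rmorphB /= map_polyXn map_polyC /= -[d%:A]z2.
  by rewrite polyCN opprK -subr_sqr rmorphXn.
have pO : map_poly (in_alg E) ('X^2 - d%:P) \is a polyOver 1%VS.
  by apply/polyOver1P; eexists.
have spl : splittingFieldFor 1%VS (map_poly (in_alg E) ('X^2 - d%:P)) {:E}.
  exists [:: z; - z]; first by rewrite p1 eqpxx.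
  apply/eqP; rewrite eqEsubv subvf -zE adjoin_cons /=.
  exact: subv_adjoin_seq.
pose ax := FieldExt_isSplittingField.Build _ E (ex_intro2 _ _ (map_poly (in_alg E) ('X^2 - d%:P)) pO spl).
pose E' : splittingFieldType K := HB.pack E ax.
have qE : quad_gen (in_alg E : {rmorphism K -> E}) d z.
  split=> // [x|a e]; last first.
    apply: (nsq a); apply: (@fmorph_inj _ _ (in_alg E : {rmorphism K -> E})).
  by apply: etrans (rmorphXn (in_alg E) 2 a) _; rewrite -[RHS]z2 -e.
  have xz : x \in <<1; z>>%VS by rewrite zE memvf.
  have /polyOverP pC := Fadjoin_polyOver 1%AS z x.
  have sp := size_Fadjoin_poly 1%AS z x.
  rewrite -(Fadjoin_poly_eq xz).
  have deg : adjoin_degree 1%AS z = 2%N.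
    by rewrite /adjoin_degree zE dimE sz dimv1 divn1.
  have /vlineP[a ea] := pC 0%N; have /vlineP[b eb] := pC 1%N.
  exists a, b; rewrite (horner_coef_wide _ (n := 2)) -?deg //.
  by rewrite deg !big_ord_recl big_ord0 /= ea eb expr0 mulr1 addr0 expr1.
have [g gbij gE] := quad_isom qE qL.
exists E', g; split=> //.
apply/splitting_galoisField.
exists (map_poly (in_alg E) ('X^2 - d%:P)); split => //.
rewrite separable_map unlock.
rewrite derivB derivXn derivC subr0 /=.
have d0 : d != 0 by apply/eqP => d0; apply: (nsq 0); rewrite d0 expr0n.
apply/Bezout_coprimepP.
(* A Bezout identity for X^2 - d and its derivative 2X: the combination is the constant 2d, which is
   nonzero. *)
exists ((- 2%:R)%:P, 'X); rewrite /= -[X in _ %= X]/(1%:P).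
have -> : (- 2%:R)%:P * ('X^2 - d%:P) + 'X * ('X *+ 2) = (2%:R * d)%:P.
  by rewrite !(polyCN, polyCM, polyC_natr); ring.
by rewrite polyC_eqp1 ?mulf_neq0 //.
Qed.

End QuadraticExtensions.

(** * Rational functions that are not squares *)

Section RationalFunctions.
Variable k : fieldType.

(** If e = n / m then n^2 = D m^2, and the multiplicity of r is even in n^2 and in m^2. *)
Lemma odd_mup_nonsquare (D : {poly k}) r (e : {fraction {poly k}}) :
  D != 0 -> odd (mup r D) -> e ^+ 2 <> tofrac D.
Proof.
move=> D0 oD; have [n [m [m0 ->]]] := fracP e.
rewrite expr_div_n => /(canRL (divfK _)); rewrite -!tofracXn -tofracM.
rewrite tofrac_eq0 expf_neq0 // => /(_ isT)/eqP; rewrite tofrac_eq => /eqP nE.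
have n0 : n != 0.
  by apply: contraTneq (mulf_neq0 D0 (expf_neq0 2 m0)) => n0; rewrite -nE n0 expr0n eqxx.
have := congr1 (fun q => odd (mup r q)) nE.
by rewrite /= !expr2 !mupM ?mulf_neq0 // !oddD !addbb oD.
Qed.

(** An even [size] means an odd degree. This is the same parity argument at the point at
    infinity. *)
Lemma odd_degree_nonsquare (D : {poly k}) (e : {fraction {poly k}}) :
  D != 0 -> ~~ odd (size D) -> e ^+ 2 <> tofrac D.
Proof.
move=> D0 oD; have [n [m [m0 ->]]] := fracP e.
rewrite expr_div_n => /(canRL (divfK _)); rewrite -!tofracXn -tofracM.
rewrite tofrac_eq0 expf_neq0 // => /(_ isT)/eqP; rewrite tofrac_eq => /eqP nE.
have n0 : n != 0.
  by apply: contraTneq (mulf_neq0 D0 (expf_neq0 2 m0)) => n0; rewrite -nE n0 expr0n eqxx.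
have : odd (size D + size m + size m) = odd (size n + size n).+1.
  have := congr1 (size : {poly k} -> nat) nE.
  rewrite !expr2 !size_mul ?mulf_neq0 //.
  move: D0 m0 n0; rewrite -!size_poly_gt0.
  case: (size D) => // a; case: (size m) => // b; case: (size n) => // c _ _ _.
  move=> /(congr1 odd); rewrite !(addnS, addSn) /= !oddD.
  by case: (odd a); case: (odd b); case: (odd c).
by rewrite -addnA /= !oddD !addbb addbF (negPf oD).
Qed.

(** The determinant says that the two factors have different roots on the projective line. Either
    the root of the first is finite, hence simple in the product, or it is at infinity and the
    product has degree one. *)
Lemma split_quadratic_nonsquare (a1 b1 a2 b2 : k) (e : {fraction {poly k}}) :
  a1 * b2 - a2 * b1 != 0 ->
  e ^+ 2 <> tofrac ((a1 *: 'X + b1%:P) * (a2 *: 'X + b2%:P)).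
Proof.
move=> det.
have lin0 a b : (a != 0) || (b != 0) -> a *: 'X + b%:P != 0 :> {poly k}.
  move=> h; apply/negP => /eqP e0; case/orP: h => /eqP; apply.
    by have := congr1 (fun q : {poly k} => q`_1) e0; rewrite !coefE /= mulr1 addr0.
  by have := congr1 (fun q : {poly k} => q`_0) e0; rewrite !coefE /= mulr0 add0r.
have n1 : a1 *: 'X + b1%:P != 0 :> {poly k}.
  apply: lin0; rewrite -negb_and; apply: contra det => /andP[/eqP-> /eqP->].
  by rewrite mul0r mulr0 subr0.
have n2 : a2 *: 'X + b2%:P != 0 :> {poly k}.
  apply: lin0; rewrite -negb_and; apply: contra det => /andP[/eqP-> /eqP->].
  by rewrite mul0r mulr0 subr0.
have [a10|a10] := eqVneq a1 0.
  have [b10 a20] : b1 != 0 /\ a2 != 0.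
    by move: det; rewrite a10 mul0r sub0r oppr_eq0 mulf_eq0 negb_or => /andP[].
  apply: odd_degree_nonsquare; first by rewrite mulf_neq0.
  rewrite a10 scale0r add0r mul_polyC size_scale // size_addl ?size_scale //.
    by rewrite size_polyX.
  by rewrite size_polyX ltnS size_polyC leq_b1.
have e1 : a1 *: 'X + b1%:P = a1 *: ('X - (- b1 / a1)%:P).
  by rewrite scalerBr -[_ *: _%:P]mul_polyC -polyCM mulrC divfK // polyCN opprK.
apply: (@odd_mup_nonsquare _ (- b1 / a1)); first by rewrite mulf_neq0.
rewrite mupMl.
  rewrite e1 -mul_polyC mupMr; last by rewrite rootC.
  by have := mup_XsubCX 1 (- b1 / a1) (- b1 / a1); rewrite expr1 eqxx => ->.
rewrite rootE hornerD hornerZ hornerX hornerC; apply: contra det => /eqP h.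
have -> : a1 * b2 - a2 * b1 = a1 * (a2 * (- b1 / a1) + b2) by field.
by rewrite h mulr0.
Qed.

End RationalFunctions.

(** * Linear forms in three variables *)

Section LinearForms.
Variable k : closedFieldType.

Lemma linform_linear : linear (@linform k).
Proof.
move=> a u v; rewrite /linform scaler_sumr -big_split; apply: eq_bigr => i _.
by rewrite !mxE scalerA scalerDl.
Qed.

HB.instance Definition _ :=
  GRing.isLinear.Build k 'rV[k]_3 {mpoly k[3]} _ (@linform k) linform_linear.

Lemma linformZ a u : linform (a *: u) = a *: linform u :> {mpoly k[3]}.
Proof. exact: linearZ. Qed.

Lemma linform_homog (l : 'rV[k]_3) : linform l \is 1.-homog.
Proof. by apply: rpred_sum => i _; apply: rpredZ; rewrite dhomogX; apply/eqP; exact: mdeg1. Qed.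

Lemma linform_delta i : linform (delta_mx 0 i : 'rV[k]_3) = 'X_i.
Proof.
rewrite /linform (bigD1 i) //= mxE !eqxx scale1r big1 ?addr0 // => j ji.
by rewrite mxE eqxx (negPf ji) scale0r.
Qed.

End LinearForms.

(** * The function field of a conic over a projection *)

Section ConicFunctionField.
Variables (k : closedFieldType) (R : idomainType).
Variable p : {rmorphism {mpoly k[3]} -> R}.
Local Notation L := (homog_frac p).
Local Notation v := (@homog_frac_val k R p).

Lemma homog_frac_valD (x y : L) : v (x + y) = v x + v y.
Proof. exact: (rmorphD (val : L -> _)). Qed.

Lemma homog_frac_valB (x y : L) : v (x - y) = v x - v y.
Proof. exact: (rmorphB (val : L -> _)). Qed.

Lemma homog_frac_valM (x y : L) : v (x * y) = v x * v y.
Proof. exact: (rmorphM (val : L -> _)). Qed.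

Lemma homog_frac_val0 : v 0 = 0.
Proof. exact: (rmorph0 (val : L -> _)). Qed.

Lemma homog_frac_val1 : v 1 = 1.
Proof. exact: (rmorph1 (val : L -> _)). Qed.

Lemma homog_frac_valV (x : L) : v x^-1 = (v x)^-1.
Proof. exact: (fmorphV (val : L -> _)). Qed.

Lemma homog_frac_val_inj : injective v.
Proof. exact: (@val_inj _ _ L). Qed.

Lemma homog_fracP d (G H : {mpoly k[3]}) : G \is d.-homog -> H \is d.-homog ->
  p H != 0 -> exists x : L, v x = ratio_of p G H.
Proof.
move=> hG hH H0.
have e : ratio_of p G H \in degree_zero p by apply/asboolP; exists d, G, H.
by exists (HomogFrac e).
Qed.

Lemma ratio_of_den0 G H : p H = 0 -> ratio_of p G H = 0.
Proof. by move=> H0; rewrite /ratio_of H0 tofrac0 invr0 mulr0. Qed.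

Lemma ratio_ofM G H G' H' :
  ratio_of p (G * G') (H * H') = ratio_of p G H * ratio_of p G' H'.
Proof. by rewrite /ratio_of mulf_div !rmorphM. Qed.

Lemma ratio_ofD G G' H : ratio_of p (G + G') H = ratio_of p G H + ratio_of p G' H.
Proof. by rewrite /ratio_of -mulrDl !rmorphD. Qed.

Lemma ratio_of1 H : p H != 0 -> ratio_of p H H = 1.
Proof. by move=> H0; rewrite /ratio_of divff // tofrac_eq0. Qed.

Lemma ratio_ofZ c G H : ratio_of p (c *: G) H = ratio_of p c%:MP 1 * ratio_of p G H.
Proof. by rewrite -mul_mpolyC -[H in LHS]mul1r ratio_ofM. Qed.

Lemma ratio_const_morphism : exists i : {rmorphism k -> L},
  forall c, v (i c) = ratio_of p c%:MP 1.
Proof.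
have ex c : exists x : L, v x = ratio_of p c%:MP 1.
  apply: (@homog_fracP 0); rewrite ?dhomog1 ?rmorph1 ?oner_eq0 //.
  by rewrite -[_%:MP]mulr1 mul_mpolyC dhomogZ // dhomog1.
pose i c := projT1 (cid (ex c)).
have iE c : v (i c) = ratio_of p c%:MP 1 by rewrite /i; case: cid.
have r1 c : ratio_of p c%:MP 1 = tofrac (p c%:MP).
  by rewrite /ratio_of rmorph1 tofrac1 divr1.
have iB : zmod_morphism i.
  move=> a b; apply: homog_frac_val_inj; rewrite homog_frac_valB !iE !r1.
  by rewrite -tofracB -rmorphB -mpolyCB.
have iM : monoid_morphism i.
  split; first by apply: homog_frac_val_inj; rewrite homog_frac_val1 iE r1 !rmorph1.
  move=> a b; apply: homog_frac_val_inj; rewrite homog_frac_valM !iE !r1.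
  by rewrite -tofracM -rmorphM -mpolyCM.
pose zM := GRing.isZmodMorphism.Build _ _ i iB.
pose mM := GRing.isMonoidMorphism.Build _ _ i iM.
pose I : {rmorphism k -> L} := HB.pack i zM mM.
by exists I.
Qed.

Variables l1 l2 : 'rV[k]_3.
Hypothesis l2N0 : p (linform l2) != 0.

(** This is [is_pullback] with [coord_pi] replaced by any morphism p into a domain. *)
Definition pullback_spec (phi : {rmorphism {fraction {poly k}} -> L}) :=
  (forall c : k, v (phi (tofrac c%:P)) = ratio_of p c%:MP 1) /\
  v (phi (tofrac 'X)) = ratio_of p (linform l1) (linform l2).

(** The hypothesis says that t = l1 / l2 is not a constant. Over an algebraically closed field t is
    then transcendental: a polynomial that kills t splits, and one of its factors X - r would kill
    t. Evaluation at t thus extends to k(t). *)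
Lemma pullback_exists : (forall r, p (linform (l1 - r *: l2)) != 0) ->
  exists phi, pullback_spec phi.
Proof.
move=> l12; have [i iE] := ratio_const_morphism.
have [t tE] := homog_fracP (linform_homog l1) (linform_homog l2) l2N0.
have tN r : t != i r.
  apply/eqP => tr; have /eqP := l12 r; apply; apply/eqP.
  rewrite -tofrac_eq0 raddfB /= linearZ rmorphB /= tofracB subr_eq0 -mul_mpolyC.
  move/(congr1 v): tr; rewrite tE iE /ratio_of rmorph1 tofrac1 divr1 rmorphM.
  by rewrite tofracM => /(canRL (divfK _)) ->; rewrite ?tofrac_eq0.
pose f : {rmorphism {poly k} -> L} := horner_morph (fun c => mulrC t (i c)).
have finj q : f q = 0 -> q = 0.
  rewrite /f /= /horner_morph => q0; apply/eqP/negP => /negP qN0.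
  have [s sE] := closed_field_poly_normal q.
  move: q0; rewrite sE -mul_polyC rmorphM /= map_polyC hornerM hornerC.
  rewrite rmorph_prod horner_prod => /eqP.
  rewrite mulf_eq0 fmorph_eq0 lead_coef_eq0 (negPf qN0) /= prodf_seq_eq0.
  case/hasP => r _ /=; rewrite rmorphB /= map_polyX map_polyC !hornerE subr_eq0.
  by rewrite (negPf (tN r)).
have [phi phiE] := frac_extend finj.
exists phi; split=> [c|]; rewrite phiE /f /= /horner_morph.
  by rewrite map_polyC hornerC iE.
by rewrite map_polyX hornerX tE.
Qed.

Variables (phi : {rmorphism {fraction {poly k}} -> L}) (l3 : 'rV[k]_3).
Hypothesis phiE : pullback_spec phi.
Hypothesis span : forall i : 'I_3, exists a b c,
  'X_i = linform (a *: l1 + b *: l2 + c *: l3).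

(** A quadratic relation between l3, l1 and l2, divided by l2^2, is an equation for the square of y
    = l3 / l2. *)
Lemma pullback_generator : exists y : L,
  v y = ratio_of p (linform l3) (linform l2) /\
  forall d2 d1 d0, p (linform l3 ^+ 2) = p (d2 *: linform l1 ^+ 2 +
      d1 *: (linform l1 * linform l2) + d0 *: linform l2 ^+ 2) ->
  y ^+ 2 = phi (tofrac (d2 *: 'X^2 + d1 *: 'X + d0%:P)).
Proof.
have [phiC phiX] := phiE.
have [y yE] := homog_fracP (linform_homog l3) (linform_homog l2) l2N0.
exists y; split=> // d2 d1 d0 q0; apply: homog_frac_val_inj.
rewrite expr2 homog_frac_valM yE -ratio_ofM -expr2 /ratio_of q0 -/(ratio_of p _ _).
rewrite -!mul_polyC expr2 !tofracD !tofracM !(rmorphD phi) !(rmorphM phi).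
rewrite !homog_frac_valD !homog_frac_valM !phiC phiX !ratio_ofD !ratio_ofZ.
rewrite -ratio_ofM expr2; congr (_ + _ * _ + _).
- by rewrite !ratio_ofM.
- by rewrite ratio_ofM ratio_of1 ?mulr1.
- by rewrite ratio_of1 ?mulr1 // rmorphM mulf_neq0.
Qed.

(** The ratios X_i / l2 lie in the span of 1 and t y-multiples given by k(t) + k(t) y; the span is
    closed under the field operations because y^2 is in k(t). So it contains G / l2^e for every form
    G of degree e, and then all quotients of such elements. *)
Lemma pullback_span y : v y = ratio_of p (linform l3) (linform l2) ->
  (exists d, y ^+ 2 = phi d) -> forall x, quad_span phi y x.
Proof.
move=> yE [d y2]; have [phiC phiX] := phiE.
pose S := quad_span phi y.
have SD x x' : S x -> S x' -> S (x + x') by exact: quad_spanD.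
have SM x x' : S x -> S x' -> S (x * x') by exact: (quad_spanM y2).
have [t tE] : exists t : L, v t = ratio_of p (linform l1) (linform l2).
  by exists (phi (tofrac 'X)).
have SX (i : 'I_3) (x : L) : v x = ratio_of p 'X_i (linform l2) -> S x.
  have [a [b [c ->]]] := span i; rewrite !linearD !linearZ /= !ratio_ofD !ratio_ofZ.
  rewrite -!phiC -phiX -yE ratio_of1 // mulr1 => xE.
  exists (tofrac a%:P * tofrac 'X + tofrac b%:P), (tofrac c%:P).
  apply: homog_frac_val_inj; rewrite xE.
  rewrite homog_frac_valD homog_frac_valM; congr (_ + _).
  by rewrite (rmorphD phi) (rmorphM phi) homog_frac_valD homog_frac_valM.
have Spow e (G : {mpoly k[3]}) : G \is e.-homog ->
    exists2 x, S x & v x = ratio_of p G (linform l2 ^+ e).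
  move=> hG; rewrite (mpolyE G) big_seq.
  elim/big_rec: _ => [|m G' mG [x Sx xE]].
    exists 0; first exact: quad_span0.
    by rewrite /ratio_of rmorph0 tofrac0 mul0r homog_frac_val0.
  have me : mdeg m = e by exact: (dhomog_mf hG).
  have [x' Sx' x'E] : exists2 x, S x & v x = ratio_of p 'X_[m] (linform l2 ^+ e).
    have Xpow (i : 'I_3) n : exists2 x, S x & v x = ratio_of p ('X_i ^+ n) (linform l2 ^+ n).
      have h : ('X_i : {mpoly k[3]}) \is 1.-homog.
        by rewrite dhomogX; apply/eqP; exact: mdeg1.
      have [z zE] := homog_fracP h (linform_homog l2) l2N0.
      elim: n => [|n [w Sw wE]].
        exists 1; first exact: quad_span1.
        by rewrite !expr0 ratio_of1 ?rmorph1 ?oner_eq0 // homog_frac_val1.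
      exists (z * w); first by apply: SM => //; apply: SX zE.
      by rewrite homog_frac_valM zE wE !exprS ratio_ofM.
    rewrite -me mdegE mpolyXE_id !big_ord_recl !big_ord0 !mulr1 addn0 !exprD.
    have [x0 S0 e0] := Xpow ord0 (m ord0).
    have [x1 S1 e1] := Xpow (lift ord0 ord0) (m (lift ord0 ord0)).
    have [x2 S2 e2] := Xpow (lift ord0 (lift ord0 ord0)) (m (lift ord0 (lift ord0 ord0))).
    exists (x0 * (x1 * x2)); first by apply: (SM) => //; exact: SM.
    by rewrite !homog_frac_valM e0 e1 e2 !ratio_ofM.
  exists (phi (tofrac (G@_m)%:P) * x' + x); first by apply: (SD) => //; apply: SM => //; exact: quad_span_base.
  rewrite homog_frac_valD homog_frac_valM x'E xE phiC.
  by rewrite ratio_ofD ratio_ofZ.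
move=> x; have /asboolP[e [G [H [hG hH H0 xE]]]] := valP x.
have [g Sg gE] := Spow e G hG; have [h Sh hE] := Spow e H hH.
(* G / H is the quotient of G / l2^e by H / l2^e. *)
rewrite (_ : x = g * h^-1); first by apply: SM => //; exact: (quad_spanV y2).
apply: homog_frac_val_inj; rewrite homog_frac_valM homog_frac_valV.
rewrite -[LHS]/(val x) xE gE hE /ratio_of.
rewrite invf_div mulrA divfK // tofrac_eq0 rmorphXn expf_neq0 //.
Qed.

End ConicFunctionField.

(** * Irreducibility of smooth conics *)

Section Basis.
Variable k : closedFieldType.
Implicit Types (l u v : 'rV[k]_3).

Definition indep3 l1 l2 l3 := forall a b c : k,
  a *: l1 + b *: l2 + c *: l3 = 0 -> [/\ a = 0, b = 0 & c = 0].

Lemma sum3 (V : nmodType) (F : 'I_3 -> V) :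
  \sum_i F i = F ord0 + F (lift ord0 ord0) + F (lift ord0 (lift ord0 ord0)).
Proof. by rewrite !big_ord_recl big_ord0 addr0 addrA. Qed.

Lemma pairingDl u v x : pairing (u + v) x = pairing u x + pairing v x.
Proof. by rewrite /pairing -big_split; apply: eq_bigr => i _; rewrite mxE mulrDl. Qed.

Lemma pairingZl a u x : pairing (a *: u) x = a * pairing u x.
Proof. by rewrite /pairing mulr_sumr; apply: eq_bigr => i _; rewrite mxE mulrA. Qed.

Lemma pairingC u x : pairing u x = pairing x u.
Proof. by apply: eq_bigr => i _; rewrite mulrC. Qed.

Lemma pairing0r u : pairing u 0 = 0.
Proof. by rewrite /pairing big1 // => i _; rewrite mxE mulr0. Qed.

Lemma pairingE u x : pairing u x = (u *m x^T) 0 0.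
Proof. by rewrite mxE; apply: eq_bigr => i _; rewrite mxE. Qed.

(** The u_j are the columns of the inverse of the matrix with rows l_i, so pairing with them reads
    off coordinates. *)
Lemma dual_basis l1 l2 l3 : indep3 l1 l2 l3 -> exists u1 u2 u3,
  [/\ [/\ pairing l1 u1 = 1, pairing l1 u2 = 0 & pairing l1 u3 = 0],
      [/\ pairing l2 u1 = 0, pairing l2 u2 = 1 & pairing l2 u3 = 0],
      [/\ pairing l3 u1 = 0, pairing l3 u2 = 0 & pairing l3 u3 = 1] &
      forall v, v = pairing v u1 *: l1 + pairing v u2 *: l2 + pairing v u3 *: l3].
Proof.
move=> ind.
pose W : 'M[k]_3 := \matrix_i [:: l1; l2; l3]`_i.
have mulW (v : 'rV_3) : v *m W = v 0 ord0 *: l1 + v 0 (lift ord0 ord0) *: l2 +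
    v 0 (lift ord0 (lift ord0 ord0)) *: l3.
  by rewrite mulmx_sum_row sum3 !rowK.
have Wu : W \in unitmx.
  rewrite -row_free_unit; apply/inj_row_free => v; rewrite mulW => /ind[v0 v1 v2].
  apply/rowP => i; rewrite mxE.
  by case: i => -[|[|[|//]]] h; [apply: etrans v0|apply: etrans v1|apply: etrans v2];
    congr (v 0 _); apply: val_inj.
pose U := invmx W.
exists (\row_i U i ord0), (\row_i U i (lift ord0 ord0)),
  (\row_i U i (lift ord0 (lift ord0 ord0))).
have pE v j : pairing v (\row_i U i j) = (v *m U) 0 j.
  by rewrite mxE; apply: eq_bigr => i _; rewrite mxE.
have vE v : v = pairing v (\row_i U i ord0) *: l1 +
    pairing v (\row_i U i (lift ord0 ord0)) *: l2 +
    pairing v (\row_i U i (lift ord0 (lift ord0 ord0))) *: l3.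
  by rewrite !pE -mulW mulmxKV.
have uniq v a b c : v = a *: l1 + b *: l2 + c *: l3 ->
    [/\ pairing v (\row_i U i ord0) = a, pairing v (\row_i U i (lift ord0 ord0)) = b
      & pairing v (\row_i U i (lift ord0 (lift ord0 ord0))) = c].
  move=> e; have := vE v.
  move/eqP; rewrite {1}e -subr_eq0 => /eqP h.
  have [] := ind (a - pairing v (\row_i U i ord0))
    (b - pairing v (\row_i U i (lift ord0 ord0)))
    (c - pairing v (\row_i U i (lift ord0 (lift ord0 ord0)))).
    rewrite -[RHS]h !scalerBl [in RHS]opprD [in RHS]addrACA.
    by rewrite [in RHS]opprD [in RHS](addrACA (a *: l1)).
  by move=> /subr0_eq<- /subr0_eq<- /subr0_eq<-.
split=> //; apply: uniq; rewrite !(scale0r, scale1r, addr0, add0r) //.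
Qed.

End Basis.

Section SplitConic.
Variable k : closedFieldType.
Hypothesis two0 : 2%:R != 0 :> k.
Variables l1 l2 l3 : 'rV[k]_3.
Hypothesis ind : indep3 l1 l2 l3.
Let F : {mpoly k[3]} := linform l3 ^+ 2 - linform l1 * linform l2.

(** In [{poly {poly k}}] the outer variable stands for [linform l1] and the inner one for
    [linform l2]. *)
Let ev1 : {rmorphism {poly k} -> {mpoly k[3]}} :=
  horner_morph (fun a => mulrC (linform l2) (mpolyC 3 a)).
Let ev : {rmorphism {poly {poly k}} -> {mpoly k[3]}} :=
  horner_morph (fun a => mulrC (linform l1) (ev1 a)).

Let ring_ind (P : {mpoly k[3]} -> Prop) :
  (forall a, P a%:MP) -> (forall i, P 'X_i) -> (forall G H, P G -> P H -> P (G + H)) ->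
  (forall G H, P G -> P H -> P (G * H)) -> forall G, P G.
Proof.
move=> PC PX PD PM G; rewrite (mpolyE G).
elim/big_rec: _ => [|m H _ PH]; first by rewrite -mpolyC0.
apply: PD => //; rewrite -mul_mpolyC; apply: (PM) => //.
rewrite mpolyXE_id; elim/big_rec: _ => [|i H' _ PH']; first by rewrite -mpolyC1.
apply: (PM) => //; elim: (m i) => [|n IH]; first by rewrite expr0 -mpolyC1.
by rewrite exprS; exact: PM.
Qed.

(* Reduction of G modulo F, viewed as a monic quadratic in [linform l3] over the
   polynomials in [linform l1] and [linform l2]. *)
Let normal_form G : exists A B Q, G = ev A + ev B * linform l3 + Q * F.
Proof.
have [u1 [u2 [u3 [_ _ _ lE]]]] := dual_basis ind.
have evC a : ev a%:P%:P = a%:MP by rewrite /ev /= horner_morphC /= horner_morphC.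
have ev1X : ev 'X = linform l1 by rewrite /ev /= horner_morphX.
have ev2X : ev 'X%:P = linform l2 by rewrite /ev /= horner_morphC /= horner_morphX.
move: ev evC ev1X ev2X => e eC e1 e2.
elim/ring_ind: G => [a|i|G1 G2|G1 G2].
- by exists a%:P%:P, 0, 0; rewrite eC rmorph0 !mul0r !addr0.
- pose d : 'rV[k]_3 := delta_mx 0 i.
  exists ((pairing d u1)%:P%:P * 'X + (pairing d u2)%:P%:P * 'X%:P), ((pairing d u3)%:P%:P), 0.
  rewrite mul0r addr0 (rmorphD e) !(rmorphM e) e1 e2 !eC !mul_mpolyC.
  by rewrite -linform_delta {1}(lE (delta_mx 0 i)) !linearD !linearZ.
- move=> [A1 [B1 [Q1 ->]]] [A2 [B2 [Q2 ->]]].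
  by exists (A1 + A2), (B1 + B2), (Q1 + Q2); rewrite !(rmorphD e); ring.
- move=> [A1 [B1 [Q1 ->]]] [A2 [B2 [Q2 ->]]].
  (* In the product, [linform l3 ^+ 2] is replaced by [F + linform l1 * linform l2]; the quotient
     below collects the multiples of F. *)
  exists (A1 * A2 + B1 * B2 * ('X * 'X%:P)), (A1 * B2 + A2 * B1).
  exists (Q1 * (e A2 + e B2 * linform l3) + Q2 * (e A1 + e B1 * linform l3)
          + Q1 * Q2 * F + e B1 * e B2).
  rewrite !(rmorphD e) !(rmorphM e) e1 e2 /F.
  by ring.
Qed.

Let pc : {rmorphism k -> {poly {poly k}}} := polyC \o polyC.

(* The parametrization (s^2 : t^2 : s t) of the conic in the coordinates
   (l1 : l2 : l3); it embeds the coordinate ring in a domain. *)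
Lemma conic_parametrization : exists theta : {rmorphism {mpoly k[3]} -> {poly {poly k}}},
  (forall G, mdvd F G <-> theta G = 0) /\ (forall l, theta (linform l) = 0 -> l = 0).
Proof.
have [u1 [u2 [u3 [[p11 p12 p13] [p21 p22 p23] [p31 p32 p33] lE]]]] := dual_basis ind.
pose t1 : {poly {poly k}} := 'X^2.
pose t2 : {poly {poly k}} := ('X^2)%:P.
pose t3 : {poly {poly k}} := 'X * 'X%:P.
(* The generic point s^2 u1 + t^2 u2 + s t u3, with s the outer and t the inner variable. By duality
   its l1, l2, l3 coordinates are s^2, t^2 and s t. *)
pose h (i : 'I_3) := pc (u1 0 i) * t1 + pc (u2 0 i) * t2 + pc (u3 0 i) * t3.
pose theta : {rmorphism {mpoly k[3]} -> {poly {poly k}}} := mmap pc h.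
have thC a : theta a%:MP = pc a by rewrite /theta /= mmapC.
have thL l : theta (linform l) = pc (pairing l u1) * t1 + pc (pairing l u2) * t2
                                  + pc (pairing l u3) * t3.
  rewrite /linform raddf_sum /= /pairing !rmorph_sum !mulr_suml -!big_split.
  apply: eq_bigr => i _ /=; rewrite mmapZ mmapX mmap1U /h !rmorphM /=; ring.
have th1 : theta (linform l1) = t1.
  by rewrite thL p11 p12 p13 rmorph1 !rmorph0 !mul0r !addr0 mul1r.
have th2 : theta (linform l2) = t2.
  by rewrite thL p21 p22 p23 rmorph1 !rmorph0 !mul0r !addr0 add0r mul1r.
have th3 : theta (linform l3) = t3.
  by rewrite thL p31 p32 p33 rmorph1 !rmorph0 !mul0r !add0r mul1r.
have thF : theta F = 0.
  rewrite /F rmorphB rmorphXn rmorphM /= th1 th2 th3.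
  by rewrite /t1 /t2 /t3 rmorphXn; ring.
exists theta; split; last first.
  move=> l; rewrite thL => e; rewrite (lE l).
  (* The images of l1, l2, l3 are distinct monomials, so the coordinates of l are coefficients of
     its image. *)
  have coef2 (q : {poly {poly k}}) i j : q = 0 -> q`_i`_j = 0 by move=> ->; rewrite !coef0.
  have := coef2 _ 2%N 0%N e; have := coef2 _ 0%N 2%N e; have := coef2 _ 1%N 1%N e.
  rewrite /t1 /t2 /t3 /pc /=.
  rewrite !(coefD, coefCM, coefXn, coefC, coefX, coefMC, coef0, eqxx, mulr0, mulr1, mul1r, addr0, add0r) /=.
  move=> -> -> ->.
  by rewrite !scale0r !addr0.
move=> G; split=> [[Q ->]|]; first by rewrite rmorphM thF mulr0.
have [A [B [Q ->]]] := normal_form G.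
(* [al A] is even in s and [al B * s t] is odd, so both vanish. *)
pose al (q : {poly {poly k}}) := map_poly (comp_poly 'X^2) q \Po 'X^2.
have sz2 (K : nzRingType) : (1 < size ('X^2 : {poly K}))%N by rewrite size_polyXn.
have al_eq0 q : al q = 0 -> q = 0.
  move/eqP; rewrite comp_poly_eq0 ?sz2 // => /eqP e.
  have inj : injective (comp_poly ('X^2 : {poly k})).
    move=> x y /eqP; rewrite -subr_eq0 -comp_polyB comp_poly_eq0 ?sz2 //.
    by rewrite subr_eq0 => /eqP.
  apply: (map_inj_poly inj (comp_poly0 _)).
  by rewrite e map_poly0.
have thev q : theta (ev q) = al q.
  have th_ev1 r : theta (ev1 r) = (r \Po 'X^2)%:P.
    rewrite /ev1 /= /horner_morph -horner_map /= -[mmap pc h _]/(theta _) th2.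
    rewrite -map_poly_comp /= /comp_poly /t2.
    rewrite -[RHS](horner_map polyC) /= -map_poly_comp; congr (_.[_]).
    by apply: eq_map_poly => a /=; rewrite -[mmap pc h _]/(theta _) thC.
  rewrite /ev /= /horner_morph -horner_map /= -[mmap pc h _]/(theta _) th1.
  rewrite -map_poly_comp /al /comp_poly -map_poly_comp; congr (_.[_]).
  by apply: eq_map_poly => a /=; exact: th_ev1.
rewrite !rmorphD !rmorphM thF mulr0 addr0 !thev th3 => e.
have al_even q : al q \Po (- 'X) = al q.
  by rewrite /al -comp_polyA comp_Xn_poly sqrrN.
have e' : al A - al B * t3 = 0.
  have := congr1 (comp_poly (- 'X)) e; rewrite comp_polyD comp_polyM !al_even.
  by rewrite comp_poly0 /t3 !comp_polyM !comp_polyC comp_polyX mulNr mulrN.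
have A0 : A = 0.
  apply: al_eq0; have : (2%:R : k)%:P%:P * al A = 0.
    by rewrite !polyC_natr -[RHS](addr0 0) -{1}e -e'; ring.
  by move/eqP; rewrite mulf_eq0 !polyC_eq0 (negPf two0) => /eqP.
have B0 : B = 0.
  apply: al_eq0; move/eqP: e; rewrite A0 /al map_poly0 comp_poly0 add0r mulf_eq0.
  by rewrite /t3 !mulf_eq0 !polyC_eq0 !polyX_eq0 !orbF => /eqP.
by exists Q; rewrite A0 B0 !rmorph0 mul0r !add0r.
Qed.

Lemma conic_prime : ~ mdvd F 1 /\
  (forall G H, mdvd F (G * H) -> mdvd F G \/ mdvd F H).
Proof.
have [th [thE _]] := conic_parametrization; split.
  by move/thE/eqP; rewrite rmorph1 oner_eq0.
move=> G H /thE/eqP; rewrite rmorphM mulf_eq0 => /orP[]/eqP/thE; by [left|right].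
Qed.

End SplitConic.

(** * Quadratic forms and dual conics *)

Section QuadraticForms.
Variable k : closedFieldType.
Implicit Types (A B : 'M[k]_3) (u v w : 'rV[k]_3).

Definition bil B u v : k := (u *m B *m v^T) 0 0.

Lemma bilDl B u v w : bil B (u + v) w = bil B u w + bil B v w.
Proof. by rewrite /bil !mulmxDl mxE. Qed.

Lemma bilZl B a u w : bil B (a *: u) w = a * bil B u w.
Proof. by rewrite /bil -!scalemxAl mxE. Qed.

Lemma bilDr B u v w : bil B u (v + w) = bil B u v + bil B u w.
Proof. by rewrite /bil linearD mulmxDr mxE. Qed.

Lemma bilZr B a u w : bil B u (a *: w) = a * bil B u w.
Proof. by rewrite /bil linearZ -scalemxAr mxE. Qed.

Lemma bilC B u v : B^T = B -> bil B u v = bil B v u.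
Proof.
move=> sB; rewrite /bil -[in LHS]sB -[u in LHS]trmxK -[in LHS]trmx_mul -trmx_mul.
by rewrite mxE mulmxA.
Qed.

Lemma bil_pairing B u v : bil B u v = pairing (u *m B) v.
Proof. by rewrite pairingE. Qed.

Lemma pairing_nondeg u : (forall v, pairing u v = 0) -> u = 0.
Proof.
move=> h; apply/rowP => i; have := h (delta_mx 0 i).
rewrite /pairing (bigD1 i) //= mxE !eqxx mulr1 big1 ?addr0 ?mxE // => j ji.
by rewrite mxE eqxx (negPf ji) mulr0.
Qed.

Definition qform A : {mpoly k[3]} := \sum_i \sum_j A i j *: ('X_i * 'X_j).

Lemma qform_linear : linear qform.
Proof.
move=> a A B; rewrite /qform scaler_sumr -big_split; apply: eq_bigr => i _.
rewrite scaler_sumr -big_split; apply: eq_bigr => j _.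
by rewrite !mxE scalerA scalerDl.
Qed.

HB.instance Definition _ :=
  GRing.isLinear.Build k 'M[k]_3 {mpoly k[3]} _ qform qform_linear.

Lemma qformD A B : qform (A + B) = qform A + qform B.
Proof. exact: linearD. Qed.

Lemma qformB A B : qform (A - B) = qform A - qform B.
Proof. exact: linearB. Qed.

Lemma qformZ a A : qform (a *: A) = a *: qform A.
Proof. exact: linearZ. Qed.

Lemma qform_tr A : qform A^T = qform A.
Proof.
rewrite /qform exchange_big; apply: eq_bigr => i _; apply: eq_bigr => j _.
by rewrite mxE mulrC.
Qed.

Lemma qform_homog A : qform A \is 2.-homog.
Proof.
apply: rpred_sum => i _; apply: rpred_sum => j _; apply: rpredZ.
by rewrite -[2%N]/(1 + 1)%N; apply: dhomogM; rewrite dhomogX; apply/eqP; exact: mdeg1.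
Qed.

Lemma qform_eval A v : (qform A).@[v 0] = bil A v v.
Proof.
transitivity (\sum_i \sum_j A i j * (v 0 i * v 0 j)).
  rewrite /qform raddf_sum; apply: eq_bigr => i _.
  by rewrite raddf_sum; apply: eq_bigr => j _ /=; rewrite mevalZ mevalM !mevalXU.
rewrite exchange_big /bil mxE; apply: eq_bigr => j _.
by rewrite !mxE mulr_suml; apply: eq_bigr => i _; ring.
Qed.

Lemma gradient_qform A v : A^T = A -> gradient (qform A) v = 2%:R *: (v *m A).
Proof.
move=> sA; apply/rowP => i; rewrite !mxE.
have dX j : ('X_j : {mpoly k[3]})^`M(i) = (j == i)%:R.
  rewrite mderivX mnm1E; have [->|_] := eqVneq j i; last by rewrite scale0r.
  rewrite scale1r (_ : U_(i) - U_(i) = 0)%MM ?mpolyX0 //.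
  by apply/mnmP => l; rewrite mnmBE subnn mnm0E.
have dXX a b : (('X_a * 'X_b : {mpoly k[3]})^`M(i)).@[v 0] =
    (a == i)%:R * v 0 b + v 0 a * (b == i)%:R.
  by rewrite mderivM mevalD !mevalM !mevalXU !dX !rmorph_nat.
rewrite /qform (raddf_sum (mderiv i)) raddf_sum.
transitivity (\sum_a \sum_b A a b * ((a == i)%:R * v 0 b + v 0 a * (b == i)%:R)).
  apply: eq_bigr => a _; rewrite (raddf_sum (mderiv i)) raddf_sum; apply: eq_bigr => b _.
  by rewrite /= mderivZ mevalZ dXX.
rewrite mulr_natl.
under eq_bigr do under eq_bigr do rewrite mulrDr.
under eq_bigr do rewrite big_split; rewrite big_split mulr2n; congr (_ + _).
  rewrite (bigD1 i) //= [X in _ + X]big1 ?addr0.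
    by apply: eq_bigr => b _; rewrite eqxx mul1r mulrC -{1}sA mxE.
  by move=> a ai; rewrite big1 // => b _; rewrite (negPf ai) mul0r mulr0.
apply: eq_bigr => a _; rewrite (bigD1 i) //= big1 ?addr0 ?eqxx.
  by rewrite mulr1 mulrC.
by move=> b bi; rewrite (negPf bi) !mulr0.
Qed.

Lemma linformM u v : linform u * linform v = qform (u^T *m v).
Proof.
rewrite /linform /qform mulr_suml; apply: eq_bigr => i _.
rewrite mulr_sumr; apply: eq_bigr => j _.
by rewrite -scalerAl -scalerAr scalerA !mxE big_ord1 !mxE.
Qed.

Lemma qform_exists (F : {mpoly k[3]}) : 2%:R != 0 :> k -> F \is 2.-homog ->
  exists2 A, A^T = A & F = qform A.
Proof.
move=> two0 hF; suff [A ->] : exists A, F = qform A.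
  (* Symmetrization; it keeps the form because [qform] does not distinguish a matrix from its
     transpose. *)
  exists (2%:R^-1 *: (A + A^T)); first by rewrite linearZ linearD /= trmxK addrC.
  by rewrite linearZ linearD /= qform_tr -mulr2n -scaler_nat scalerA mulVf ?scale1r.
rewrite (mpolyE F) big_seq; elim/big_rec: _ => [|m G mF [A ->]].
  by exists 0; rewrite linear0.
have m2 : mdeg m = 2%N by exact: (dhomog_mf hF).
have [i mi] : exists i, m i != 0%N.
  apply/existsP; apply: contraPT m2; rewrite negb_exists => /forallP m0.
  suff -> : m = 0%MM by rewrite mdeg0.
  by apply/mnmP => i; rewrite mnm0E; have := m0 i; rewrite negbK => /eqP.
have mE : m = (U_(i) + (m - U_(i)))%MM.
  apply/mnmP => j; rewrite mnmDE mnmBE mnm1E; case: eqVneq => [<-|_]; last by rewrite add0n subn0.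
  by rewrite subnKC // lt0n.
have d1 : mdeg (m - U_(i))%MM == 1%N.
  by move: m2; rewrite {1}mE mdegD mdeg1 add1n => -[->].
have [l /eqP lE] := mdeg1P _ d1.
(* A monomial of degree two is X_i X_l, the form of an elementary matrix. *)
exists (F@_m *: ((delta_mx 0 i : 'rV_3)^T *m delta_mx 0 l) + A).
rewrite linearD linearZ /= -linformM !linform_delta.
by rewrite {2}mE lE mpolyXD.
Qed.

End QuadraticForms.

(** * Dual conics and the polar of an outer point *)

Section DualConics.
Variable k : closedFieldType.
Hypothesis two0 : 2%:R != 0 :> k.
Implicit Types (A B : 'M[k]_3) (p u v w : 'rV[k]_3) (P T : Defs.point k).

Lemma point_gen T : exists2 w, w != 0 & val T = <[w]>%VS.
Proof.
have dT := eqP (valP T); have T0 : val T != 0%VS by rewrite -dimv_eq0 dT.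
exists (vpick (val T)); first by rewrite vpick0.
by apply/eqP; rewrite eq_sym eqEdim -memvE memv_pick dim_vline dT vpick0 T0.
Qed.

Lemma span_point w : w != 0 -> exists T, val T = <[w]>%VS.
Proof.
move=> w0; have dw : \dim <[w]>%VS == 1%N by rewrite dim_vline w0.
by exists (exist _ <[w]>%VS dw).
Qed.

(** A nonzero kernel vector of A would be a singular point of the conic. *)
Lemma nonsingular_unit A : A^T = A -> nonsingular (qform A) -> A \in unitmx.
Proof.
move=> sA nsA; rewrite -row_free_unit; apply/inj_row_free => v vA0.
apply/eqP; apply/negPn/negP => v0; have := nsA v v0.
by rewrite qform_eval gradient_qform // vA0 scaler0 /bil vA0 mul0mx mxE eqxx => /(_ erefl).
Qed.

Lemma bil_invmx A u v : A^T = A -> A \in unitmx ->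
  bil (invmx A) (u *m A) (v *m A) = bil A u v.
Proof. by move=> sA uA; rewrite /bil trmx_mul sA mulmxK // mulmxA. Qed.

Lemma vanishes_qform A P v : val P = <[v]>%VS ->
  vanishes (qform A) P <-> bil A v v = 0.
Proof.
move=> PE; split=> [/(_ v)|v0 u].
  by rewrite PE memv_line qform_eval; apply.
by rewrite PE => /vlineP[c ->]; rewrite qform_eval bilZl bilZr v0 !mulr0.
Qed.

(** The inverse form vanishes on all tangents, hence on their closure. Conversely every zero w of it
    is itself a tangent line, at the point w A^-1, so the closure adds nothing. *)
Lemma dual_curveP A T : A^T = A -> A \in unitmx ->
  dual_curve (qform A) T <-> vanishes (qform (invmx A)) T.
Proof.
move=> sA uA; split.
  move/(_ 2%N _ (qform_homog _)); apply=> P [Q Qv [v vQ PE]].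
  apply/(vanishes_qform _ PE); rewrite gradient_qform // bilZl bilZr bil_invmx //.
  by rewrite -qform_eval Qv // !mulr0.
move=> Tv d G _; apply; have [w w0 TE] := point_gen T.
(* The factor 1/2 cancels the 2 in the gradient, which then equals w. *)
pose v := 2%:R^-1 *: (w *m invmx A).
have gE : gradient (qform A) v = w.
  by rewrite gradient_qform // /v -scalemxAl mulmxKV // scalerA divff // scale1r.
have v0 : v != 0.
  by apply: contraNneq w0 => v0; rewrite -gE v0 gradient_qform // mul0mx scaler0.
have [P PE] := span_point v0; exists P; last by exists v; rewrite ?PE ?memv_line ?gE.
apply/(vanishes_qform _ PE); rewrite -bil_invmx // /v -scalemxAl mulmxKV //.
by rewrite bilZl bilZr (vanishes_qform _ TE).1 // !mulr0.
Qed.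

Definition indep2 u v := forall a b : k, a *: u + b *: v = 0 -> a = 0 /\ b = 0.

Lemma free_indep2 u v : free [:: u; v] <-> indep2 u v.
Proof.
split=> [fr a b e|ind].
  have /freeP := fr => /(_ (fun i => [:: a; b]`_i)).
  rewrite !big_ord_recl big_ord0 /= addr0 => /(_ e) h.
  by split; [exact: (h ord0)|exact: (h (lift ord0 ord0))].
apply/freeP => c; rewrite !big_ord_recl big_ord0 /= addr0 => /ind[c0 c1].
by case=> -[|[|//]] h; [apply: etrans c0|apply: etrans c1]; congr (c _); apply: val_inj.
Qed.

Lemma indep2_comb u v a1 b1 a2 b2 : indep2 u v -> a1 * b2 - a2 * b1 != 0 ->
  indep2 (a1 *: u + b1 *: v) (a2 *: u + b2 *: v).
Proof.
move=> ind det a c e; have [] := ind (a * a1 + c * a2) (a * b1 + c * b2).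
  by rewrite -[RHS]e !scalerDr !scalerDl !scalerA addrACA.
move=> e1 e2; have d1 : a * (a1 * b2 - a2 * b1) = 0.
  transitivity ((a * a1 + c * a2) * b2 - (a * b1 + c * b2) * a2); first by ring.
  by rewrite e1 e2 !mul0r subrr.
have d2 : c * (a1 * b2 - a2 * b1) = 0.
  transitivity ((a * b1 + c * b2) * a1 - (a * a1 + c * a2) * b1); first by ring.
  by rewrite e1 e2 !mul0r subrr.
by split; apply/eqP; move/eqP: d1; move/eqP: d2; rewrite !mulf_eq0 (negPf det) !orbF.
Qed.

Section Decomposition.
Variables (A : 'M[k]_3) (p w1 w2 : 'rV[k]_3).
Hypotheses (sA : A^T = A) (uA : A \in unitmx).
Hypotheses (pw1 : pairing p w1 = 0) (pw2 : pairing p w2 = 0).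
Hypothesis ind : indep2 w1 w2.
Let B := invmx A.
Let sB : B^T = B. Proof. by rewrite /B trmx_inv sA. Qed.
Let l3 := p *m A.
Let x := bil B w1 w1.
Let b := bil B w1 w2.
Let z := bil B w2 w2.

Let Bl3 w : bil B l3 w = pairing p w.
Proof. by rewrite bil_pairing mulmxK. Qed.

Let B_nondeg w : (forall u, bil B w u = 0) -> w = 0.
Proof.
move=> h; have : w *m B = 0 by apply: pairing_nondeg => u; rewrite -bil_pairing.
by move/(congr1 (mulmx^~ A)); rewrite mulmxKV // mul0mx.
Qed.

Hypothesis outer : bil A p p != 0.

(** Pairing with p kills w1 and w2 but takes the value [bil A p p] on the polar l3. *)
Lemma polar_indep : indep3 w1 w2 l3.
Proof.
move=> a c d e; have d0 : d = 0.
  have := congr1 (bil B l3) e; rewrite !bilDr !bilZr !Bl3 pw1 pw2 !mulr0 !add0r.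
  rewrite pairing0r pairingC -bil_pairing.
  by move/eqP; rewrite mulf_eq0 (negPf outer) orbF => /eqP.
by move: e; rewrite d0 scale0r addr0 => /ind[].
Qed.

Let B_ext w : bil B w w1 = 0 -> bil B w w2 = 0 -> bil B w l3 = 0 -> w = 0.
Proof.
move=> e1 e2 e3; apply: B_nondeg => u.
have [u1 [u2 [u3 [_ _ _ uE]]]] := dual_basis polar_indep.
by rewrite (uE u) !bilDr !bilZr e1 e2 e3 !mulr0 !addr0.
Qed.

(** The span of w1 and w2 is the B-orthogonal complement of l3, which is not isotropic, so B stays
    nondegenerate on it and its Gram determinant is nonzero. *)
Lemma disc_neq0 : x * z - b ^+ 2 != 0.
Proof.
apply/eqP => d0.
have l30 u v a c : pairing p u = 0 -> pairing p v = 0 -> bil B (a *: u + c *: v) l3 = 0.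
  by move=> e1 e2; rewrite bilC // Bl3 pairingC pairingDl !pairingZl !(pairingC _ p) e1 e2 !mulr0 addr0.
(* The coefficients here and in the next combination are the rows of the adjugate of the Gram
   matrix; both vectors are in the radical if the determinant vanishes. *)
have /ind[_ b0] : z *: w1 + (- b) *: w2 = 0.
  apply: B_ext; rewrite ?l30 // bilDl !bilZl -/x -/b -/z ?(bilC w2 w1 sB) -/b.
    by rewrite -[RHS]d0; ring.
  by ring.
have {}b0 : b = 0 by apply/eqP; rewrite -oppr_eq0 b0.
have /ind[_ x0] : (- b) *: w1 + x *: w2 = 0.
  apply: B_ext; rewrite ?l30 // bilDl !bilZl -/x -/b -/z ?(bilC w2 w1 sB) -/b.
    by ring.
  by rewrite -[RHS]d0; ring.
have : w1 = 0.
  apply: B_ext => //; first by have := l30 w1 w2 1 0 pw1 pw2; rewrite scale1r scale0r addr0.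
move=> w10; have [] := ind (a := 1) (b := 0); last by move/eqP; rewrite oner_eq0.
by rewrite w10 scaler0 scale0r addr0.
Qed.

(* In the basis w1, w2, l3 the dual form is block diagonal, since l3 is the polar
   of p; inverting the blocks gives the equation of the conic. *)
Lemma conic_decomposition : qform A =
  (bil A p p)^-1 *: linform l3 ^+ 2 + (x * z - b ^+ 2)^-1 *:
   (z *: linform w1 ^+ 2 - (2%:R * b) *: (linform w1 * linform w2) + x *: linform w2 ^+ 2).
Proof.
have d0 := disc_neq0; set dl := x * z - _ in d0 *; set f := bil A p p.
have f0 : f != 0 := outer.
pose M := f^-1 *: (l3^T *m l3) + dl^-1 *: (z *: (w1^T *m w1)
  - b *: (w1^T *m w2 + w2^T *m w1) + x *: (w2^T *m w2)).
have -> : A = M; last first.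
  rewrite /M !expr2 !linformM.
  have sw : qform (w2^T *m w1) = qform (w1^T *m w2).
    by rewrite -qform_tr trmx_mul trmxK.
  rewrite !(qformB, qformD, qformZ) sw.
  by rewrite -[qform _ + qform _]mulr2n -scaler_nat [b *: (_ *: _)]scalerA (mulrC b).
have act w : w *m B *m M = f^-1 *: (bil B w l3 *: l3) + dl^-1 *: (z *: (bil B w w1 *: w1)
    - b *: (bil B w w1 *: w2 + bil B w w2 *: w1) + x *: (bil B w w2 *: w2)).
  have o (u v : 'rV[k]_3) : w *m B *m (u^T *m v) = bil B w u *: v.
    by rewrite mulmxA [_ *m u^T]mx11_scalar mul_scalar_mx.
  by rewrite /M !(mulmxDr, mulmxN) -!scalemxAr !(mulmxDr, mulmxN) -!scalemxAr !mulmxDr !o.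
have Bw3 w : bil B w l3 = pairing p w by rewrite bilC // Bl3.
have fix3 : l3 *m B *m M = l3.
  rewrite act !Bl3 pw1 pw2 pairingC -bil_pairing -/f.
  by apply/rowP => i; rewrite !mxE; field; rewrite f0 d0.
have fix1 : w1 *m B *m M = w1.
  rewrite act Bw3 pw1 -/x -/b; apply/rowP => i; rewrite !mxE.
  by rewrite /dl; field; rewrite f0 d0.
have fix2 : w2 *m B *m M = w2.
  rewrite act Bw3 pw2 [bil B w2 w1]bilC // -/z -/b; apply/rowP => i; rewrite !mxE.
  by rewrite /dl; field; rewrite f0 d0.
have fixM w : w *m B *m M = w.
  have [u1 [u2 [u3 [_ _ _ wE]]]] := dual_basis polar_indep.
  by rewrite (wE w) !mulmxDl -!scalemxAl fix1 fix2 fix3.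
by apply/row_matrixP => i; rewrite -[LHS]fixM -!row_mul mulmxV // mul1mx.
Qed.

End Decomposition.
End DualConics.

(** * Branch points of the projection of a conic from an outer point *)

Section ConicProjection.
Variable k : closedFieldType.
Hypothesis two0 : 2%:R != 0 :> k.
Implicit Types (A : 'M[k]_3) (p l w : 'rV[k]_3).

Lemma sqrt_exists (c : k) : exists g : k, g ^+ 2 = c.
Proof.
have sz : size ('X^2 - c%:P : {poly k}) != 1%N by rewrite size_XnsubC.
have [g] := closed_rootP _ sz.
by rewrite rootE !hornerE subr_eq0 => /eqP; exists g.
Qed.

Lemma mdvdZ c (G H : {mpoly k[3]}) : c != 0 -> mdvd (c *: G) H <-> mdvd G H.
Proof.
move=> c0; split=> -[Q ->].
  by exists (c *: Q); rewrite -scalerAl -scalerAr.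
by exists (c^-1 *: Q); rewrite -scalerAl -scalerAr scalerA mulVf // scale1r.
Qed.

Lemma two_neq0_frac : 2%:R != 0 :> {fraction {poly k}}.
Proof.
have -> : 2%:R = tofrac (2%:R%:P) :> {fraction {poly k}}.
  by rewrite polyC_natr rmorph_nat.
by rewrite tofrac_eq0 polyC_eq0.
Qed.

Section Conic.
Variables (A : 'M[k]_3) (p : 'rV[k]_3).
Hypotheses (sA : A^T = A) (uA : A \in unitmx).
Hypothesis outer : bil A p p != 0.
Let B := invmx A.
Let f := bil A p p.

(* With P = <p> and t = l1 / l2, the tangent lines to the conic through P are the
   zeros of the branch polynomial, and k(C) = k(t)(y) with
   y^2 = branch_coef * branch_poly for y = (p *m A) / l2. *)
Definition branch_poly l1 l2 : {poly k} :=
  bil B l2 l2 *: 'X^2 - (2%:R * bil B l1 l2) *: 'X + (bil B l1 l1)%:P.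

Definition branch_coef l1 l2 : k :=
  - (f / (bil B l1 l1 * bil B l2 l2 - bil B l1 l2 ^+ 2)).

(** Here phi is any pullback, so the lemma serves both for the pullbacks constructed below and for
    those supplied by an SG point. *)
Lemma conic_function_field (C : irr_curve k) l1 l2
    (phi : {rmorphism {fraction {poly k}} -> funfield C}) :
  Defs.form C = qform A -> pairing p l1 = 0 -> pairing p l2 = 0 -> indep2 l1 l2 ->
  is_pullback l1 l2 phi ->
  exists2 y, y ^+ 2 = phi (tofrac (branch_coef l1 l2 *: branch_poly l1 l2))
           & forall x, quad_span phi y x.
Proof.
move=> CE pl1 pl2 ind phiE; have [phiC phiX] := phiE.
have l2N0 : @coord_pi k C (linform l2) != 0.
  (* If l2 vanished on C, the ratio l1 / l2 would take the default value 0, so phi would kill t. *)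
  apply/eqP => l20; have : phi (tofrac 'X) = 0.
    by apply: homog_frac_val_inj; rewrite homog_frac_val0 -(ratio_of_den0 (linform l1) l20).
  by move/eqP; rewrite fmorph_eq0 tofrac_eq0 polyX_eq0.
pose l3 := p *m A.
have [y [yE y2]] := pullback_generator l2N0 l3 phiE.
have Y2 : y ^+ 2 = phi (tofrac (branch_coef l1 l2 *: branch_poly l1 l2)).
  rewrite (_ : branch_coef l1 l2 *: branch_poly l1 l2 =
    (branch_coef l1 l2 * bil B l2 l2) *: 'X^2 +
    (branch_coef l1 l2 * - (2%:R * bil B l1 l2)) *: 'X +
    (branch_coef l1 l2 * bil B l1 l1)%:P); last first.
    by rewrite /branch_poly !scalerDr -scaleNr !scalerA -[_ *: _%:P]mul_polyC -polyCM.
  apply: y2; apply/eqP; rewrite -subr_eq0 -rmorphB coord_pi_eq0; apply/asboolP.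
  (* The factor f makes the coefficient of l3^2 in the decomposition equal to 1. *)
  exists f%:MP; rewrite CE mul_mpolyC (conic_decomposition sA uA pl1 pl2 ind outer).
  rewrite scalerDr !scalerA mulfV // scale1r -/l3; congr (_ + _).
  rewrite !scalerDr -scaleNr !scalerA /branch_coef -/f -/B.
  rewrite !opprD -!scaleNr.
  by congr (_ *: _ + _ *: _ + _ *: _); ring.
exists y => //; apply: (pullback_span l2N0 phiE (l3 := l3)) => //; last by eexists; exact: Y2.
move=> i; have [u1 [u2 [u3 [_ _ _ uE]]]] := dual_basis (polar_indep uA pl1 pl2 ind outer).
exists (pairing (delta_mx 0 i) u1), (pairing (delta_mx 0 i) u2), (pairing (delta_mx 0 i) u3).
by rewrite -uE linform_delta.
Qed.

Variables w1 w2 : 'rV[k]_3.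
Hypotheses (pw1 : pairing p w1 = 0) (pw2 : pairing p w2 = 0) (ind : indep2 w1 w2).
Hypotheses (iso1 : bil B w1 w1 = 0) (iso2 : bil B w2 w2 = 0).
Let b := bil B w1 w2.

Let b0 : b != 0.
Proof.
have := disc_neq0 sA uA pw1 pw2 ind outer.
by rewrite -/B iso1 mul0r sub0r oppr_eq0 expf_eq0 /= -/b.
Qed.

Lemma conic_split : exists c l3, [/\ c != 0, indep3 w1 w2 l3 &
  qform A = c *: (linform l3 ^+ 2 - linform w1 * linform w2)].
Proof.
(* With both diagonal values zero the decomposition reads L^2 / f + (2 / b) w1 w2, where L is the
   polar of p. Factoring out -2 / b leaves -b / (2 f) as the coefficient of L^2, and g is its square
   root. *)
have [g gE] := sqrt_exists (- b / (2%:R * f)).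
have g0 : g != 0.
  suff : g ^+ 2 != 0 by rewrite expf_eq0.
  by rewrite gE mulf_eq0 oppr_eq0 invr_eq0 mulf_eq0 !negb_or two0 b0 outer.
exists (- (2%:R / b)), (g *: (p *m A)); split.
- by rewrite oppr_eq0 mulf_neq0 // invr_eq0.
- move=> a1 a2 a3; rewrite scalerA => /(polar_indep uA pw1 pw2 ind outer)[-> ->].
  by move/eqP; rewrite mulf_eq0 (negPf g0) orbF => /eqP->.
rewrite (conic_decomposition sA uA pw1 pw2 ind outer) -/B iso1 iso2 -/b.
rewrite !scale0r addr0 add0r mul0r linformZ exprZn gE scalerBr !scalerA.
rewrite scalerN scalerA sub0r.
congr (_ *: _ + _).
  rewrite -/f; field; apply/and3P; split => //; exact: outer.
congr (- (_ *: _)); field.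
by rewrite oppr_eq0 expf_eq0 b0.
Qed.

(** Primality comes from the split equation. That no linear form vanishes on C is what later makes
    every projection nonconstant on it. *)
Lemma conic_irr_curve : exists2 C : irr_curve k, Defs.form C = qform A &
  forall l, @coord_pi k C (linform l) = 0 -> l = 0.
Proof.
have [c [l3 [c0 ind3 AE]]] := conic_split.
have [nd1 ndM] := conic_prime two0 ind3.
have [theta [thE thl]] := conic_parametrization two0 ind3.
have mE G : mdvd (qform A) G <-> mdvd (linform l3 ^+ 2 - linform w1 * linform w2) G.
  by rewrite AE; exact: mdvdZ.
have n0 : qform A != 0.
  by apply: contraNneq outer => A0; rewrite -qform_eval A0 meval0.
pose C := IrrCurve n0 (ex_intro _ 2%N (qform_homog A)) (fun h => nd1 ((mE _).1 h))
  (fun G H h => match ndM G H ((mE _).1 h) with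
     or_introl h1 => or_introl ((mE _).2 h1) | or_intror h2 => or_intror ((mE _).2 h2) end).
exists C => // l /eqP; rewrite coord_pi_eq0 => /asboolP /mE /thE; exact: thl.
Qed.

(** The quadratic polynomial depends only on the coordinates of l1, l2 in w1, w2 and not on A, so
    conics with the same two tangents through P get the same extension. *)
Lemma conic_quad_gen (C : irr_curve k) a1 b1 a2 b2 :
  Defs.form C = qform A -> (forall l, @coord_pi k C (linform l) = 0 -> l = 0) ->
  a1 * b2 - a2 * b1 != 0 ->
  let l1 := a1 *: w1 + b1 *: w2 in let l2 := a2 *: w1 + b2 *: w2 in
  exists2 phi : {rmorphism {fraction {poly k}} -> funfield C}, is_pullback l1 l2 phi &
  exists y, quad_gen phi (tofrac ((a2 *: 'X + (- a1)%:P) * (b2 *: 'X + (- b1)%:P))) y.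
Proof.
move=> CE lN0 det l1 l2.
have ind12 : indep2 l1 l2 by exact: indep2_comb.
have pl1 : pairing p l1 = 0.
  by rewrite pairingC /l1 pairingDl !pairingZl ![pairing _ p]pairingC pw1 pw2 !mulr0 addr0.
have pl2 : pairing p l2 = 0.
  by rewrite pairingC /l2 pairingDl !pairingZl ![pairing _ p]pairingC pw1 pw2 !mulr0 addr0.
have l2N0 : @coord_pi k C (linform l2) != 0.
  apply/eqP => /lN0 l20; have [|_ /eqP] := ind12 0 1; last by rewrite oner_eq0.
  by rewrite l20 scale0r scaler0 addr0.
have l12N0 r : @coord_pi k C (linform (l1 - r *: l2)) != 0.
  apply/eqP => /lN0 l20; have [|/eqP] := ind12 1 (- r); last by rewrite oner_eq0.
  by rewrite scale1r scaleNr.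
have [phi phiE] := pullback_exists l2N0 l12N0.
exists phi => //; have [y y2 gen] := conic_function_field CE pl1 pl2 ind12 phiE.
have b11 : bil B l1 l1 = 2%:R * (a1 * b1 * b).
  rewrite /l1 !(bilDl, bilDr) !(bilZl, bilZr) iso1 iso2 (bilC w2 w1) ?trmx_inv ?sA // -/b.
  by ring.
have b22 : bil B l2 l2 = 2%:R * (a2 * b2 * b).
  rewrite /l2 !(bilDl, bilDr) !(bilZl, bilZr) iso1 iso2 (bilC w2 w1) ?trmx_inv ?sA // -/b.
  by ring.
have b12 : bil B l1 l2 = (a1 * b2 + a2 * b1) * b.
  rewrite /l1 /l2 !(bilDl, bilDr) !(bilZl, bilZr) iso1 iso2 (bilC w2 w1) ?trmx_inv ?sA // -/b.
  by ring.
have dE := disc_neq0 sA uA pl1 pl2 ind12 outer.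
(* The branch polynomial is 2b times the claimed product, and this constant together with
   [branch_coef] is a square in k. *)
have [e eE] := sqrt_exists (branch_coef l1 l2 * (2%:R * b)).
have e0 : e != 0.
  suff : e ^+ 2 != 0 by rewrite expf_eq0.
  rewrite eE !mulf_eq0 oppr_eq0 mulf_eq0 invr_eq0 !negb_or.
  by rewrite outer dE two0 b0.
exists (y / phi (tofrac e%:P)); apply: quad_gen_scale => //.
- by rewrite tofrac_eq0 polyC_eq0.
- rewrite y2 -tofracXn -tofracM -polyC_exp eE; congr (phi (tofrac _)).
  rewrite mul_polyC -[RHS]scalerA; congr (_ *: _).
  rewrite /branch_poly b11 b22 b12 -!mul_polyC !(polyCM, polyCD, polyCN, polyC_natr).
  by ring.
- move=> r; apply: split_quadratic_nonsquare.
  by have -> : a2 * - b1 - b2 * - a1 = a1 * b2 - a2 * b1 by ring.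
Qed.

End Conic.
End ConicProjection.

(** * Isotropic pairs *)

Section IsotropicPairs.
Variable k : closedFieldType.
Hypothesis two0 : 2%:R != 0 :> k.
Implicit Types (A B : 'M[k]_3) (p u v w : 'rV[k]_3).

Lemma bil_nondeg B w : B \in unitmx -> (forall u, bil B w u = 0) -> w = 0.
Proof.
move=> uB h; have : w *m B = 0 by apply: pairing_nondeg => u; rewrite -bil_pairing.
by move/(congr1 (mulmx^~ (invmx B))); rewrite mulmxK // mul0mx.
Qed.

Lemma indep2_neq0 w1 w2 : indep2 w1 w2 -> w1 != 0 /\ w2 != 0.
Proof.
move=> ind; split; apply/eqP => w0.
  by have [|/eqP] := ind 1 0; rewrite ?w0 ?scaler0 ?scale0r ?addr0 // oner_eq0.
by have [|_ /eqP] := ind 0 1; rewrite ?w0 ?scaler0 ?scale0r ?addr0 // oner_eq0.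
Qed.

Lemma indep3_extend p w1 w2 : p != 0 -> indep2 w1 w2 ->
  pairing p w1 = 0 -> pairing p w2 = 0 ->
  exists2 q, pairing p q != 0 & indep3 w1 w2 q.
Proof.
move=> p0 ind e1 e2.
have [q q0] : exists q, pairing p q != 0.
  apply: contrapT => h; case/eqP: p0; apply: pairing_nondeg => u.
  by apply/eqP/negPn/negP => pu; apply: h; exists u.
exists q => // a b c e.
have c0 : c = 0.
  have := congr1 (fun u => pairing u p) e.
  rewrite !pairingDl !pairingZl !(pairingC _ p) e1 e2 pairing0r !mulr0 !add0r.
  by move/eqP; rewrite mulf_eq0 (negPf q0) orbF => /eqP.
by move: e; rewrite c0 scale0r addr0 => /ind[].
Qed.

Lemma perp_span p w1 w2 u : p != 0 -> indep2 w1 w2 ->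
  pairing p w1 = 0 -> pairing p w2 = 0 -> pairing p u = 0 ->
  exists a b, u = a *: w1 + b *: w2.
Proof.
move=> p0 ind e1 e2 eu; have [q q0 ind3] := indep3_extend p0 ind e1 e2.
have [u1 [u2 [u3 [_ _ _ uE]]]] := dual_basis ind3.
exists (pairing u u1), (pairing u u2); rewrite {1}(uE u).
suff -> : pairing u u3 = 0 by rewrite scale0r addr0.
move: eu; rewrite {1}(uE u) pairingC !pairingDl !pairingZl !(pairingC _ p) e1 e2 !mulr0 !add0r.
by move/eqP; rewrite mulf_eq0 (negPf q0) orbF => /eqP.
Qed.

(** A nondegenerate form in dimension three has no totally isotropic plane. *)
Lemma isotropic_pair_neq0 B p w1 w2 : B^T = B -> B \in unitmx -> p != 0 ->
  indep2 w1 w2 -> pairing p w1 = 0 -> pairing p w2 = 0 ->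
  bil B w1 w1 = 0 -> bil B w2 w2 = 0 -> bil B w1 w2 != 0.
Proof.
move=> sB uB p0 ind e1 e2 i1 i2; apply/eqP => b0.
have [q q0 ind3] := indep3_extend p0 ind e1 e2.
have [u1 [u2 [u3 [_ _ _ uE]]]] := dual_basis ind3.
have ext w : bil B w w1 = 0 -> bil B w w2 = 0 -> bil B w q = 0 -> w = 0.
  move=> h1 h2 h3; apply: (bil_nondeg uB) => u.
  by rewrite (uE u) !bilDr !bilZr h1 h2 h3 !mulr0 !addr0.
have b0' : bil B w2 w1 = 0 by rewrite bilC.
(* The combination of w1 and w2 chosen to be orthogonal to q; it is then orthogonal to a whole
   basis. *)
have /ind[_ /eqP] : bil B w2 q *: w1 + (- bil B w1 q) *: w2 = 0.
  by apply: ext; rewrite bilDl !bilZl ?i1 ?i2 ?b0 ?b0' ?mulr0 ?addr0 //; ring.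
rewrite oppr_eq0 => /eqP q1; have [] := indep2_neq0 ind.
by rewrite (ext w1) ?eqxx.
Qed.

(** If p were on the conic, its tangent p A would lie in the span of w1, w2. It is B-orthogonal to
    both, and [bil B w1 w2] is nonzero, so p A = 0. *)
Lemma isotropic_outer A p w1 w2 : A^T = A -> A \in unitmx -> p != 0 ->
  indep2 w1 w2 -> pairing p w1 = 0 -> pairing p w2 = 0 ->
  bil (invmx A) w1 w1 = 0 -> bil (invmx A) w2 w2 = 0 -> bil A p p != 0.
Proof.
move=> sA uA p0 ind e1 e2 i1 i2.
have sB : (invmx A)^T = invmx A by rewrite trmx_inv sA.
have uB : invmx A \in unitmx by rewrite unitmx_inv.
have b0 := isotropic_pair_neq0 sB uB p0 ind e1 e2 i1 i2.
apply/eqP => f0; have [a [b lE]] : exists a b, p *m A = a *: w1 + b *: w2.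
  by apply: (perp_span p0) => //; rewrite pairingC -bil_pairing.
have Bl w : bil (invmx A) (p *m A) w = pairing p w by rewrite bil_pairing mulmxK.
have := Bl w1; have := Bl w2.
rewrite e1 e2 lE !bilDl !bilZl i1 i2 [bil _ w2 w1]bilC // !mulr0 add0r addr0.
move=> /eqP; rewrite mulf_eq0 (negPf b0) orbF => /eqP a0.
move=> /eqP; rewrite mulf_eq0 (negPf b0) orbF => /eqP c0.
case/eqP: p0; have := congr1 (mulmx^~ (invmx A)) lE.
by rewrite mulmxK // a0 c0 !scale0r addr0 mul0mx.
Qed.

(** The value of the form there is 2 a b [bil B w1 w2]. *)
Lemma isotropic_on_secant B w1 w2 a b : B^T = B -> bil B w1 w2 != 0 ->
  bil B w1 w1 = 0 -> bil B w2 w2 = 0 ->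
  bil B (a *: w1 + b *: w2) (a *: w1 + b *: w2) = 0 -> a = 0 \/ b = 0.
Proof.
move=> sB b0 i1 i2; rewrite !(bilDl, bilDr) !(bilZl, bilZr) i1 i2 [bil _ w2 w1]bilC //.
move=> e; have : 2%:R * (a * b * bil B w1 w2) = 0 by rewrite -[RHS]e; ring.
move/eqP; rewrite !mulf_eq0 (negPf two0) (negPf b0) orbF /=.
by case/orP=> /eqP; [left|right].
Qed.

(** A binary quadratic form with nonzero discriminant has two distinct roots. If z = 0, then l2 is
    one of them; otherwise both have the form l1 + t l2 and the quadratic formula applies. *)
Lemma isotropic_basis B l1 l2 : B^T = B -> indep2 l1 l2 ->
  bil B l1 l1 * bil B l2 l2 - bil B l1 l2 ^+ 2 != 0 ->
  exists a1 b1 a2 b2 : k, let w1 := a1 *: l1 + b1 *: l2 in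
    let w2 := a2 *: l1 + b2 *: l2 in
  [/\ indep2 w1 w2, bil B w1 w1 = 0 & bil B w2 w2 = 0].
Proof.
move=> sB ind; set x := bil B l1 l1; set z := bil B l2 l2; set b := bil B l1 l2 => d0.
have qE s t : bil B (s *: l1 + t *: l2) (s *: l1 + t *: l2) =
    x * s ^+ 2 + 2%:R * b * s * t + z * t ^+ 2.
  rewrite !(bilDl, bilDr) !(bilZl, bilZr) [bil _ l2 l1]bilC // -/x -/b -/z.
  by ring.
have [z0|z0] := eqVneq z 0.
  have b0 : b != 0 by move: d0; rewrite z0 mulr0 sub0r oppr_eq0 expf_eq0.
  exists 0, 1, 1, (- x / (2%:R * b)); split.
  - by apply: indep2_comb ind _; rewrite mul0r sub0r mulr1 oppr_eq0 oner_eq0.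
  - by rewrite qE z0; ring.
  - by rewrite qE z0; field; rewrite two0 b0.
have [g gE] := sqrt_exists (b ^+ 2 - x * z).
have g0 : g != 0.
  by apply: contraNneq d0 => g0; rewrite -oppr_eq0 opprB -gE g0 expr0n.
have xE : x = (b ^+ 2 - g ^+ 2) / z by rewrite gE; field.
exists 1, ((- b + g) / z), 1, ((- b - g) / z); split.
- apply: indep2_comb ind _; have -> : 1 * ((- b - g) / z) - 1 * ((- b + g) / z) = - (2%:R * g / z).
    by field.
  by rewrite oppr_eq0 !mulf_neq0 // invr_eq0.
- by rewrite qE {1}xE; field.
- by rewrite qE {1}xE; field.
Qed.

End IsotropicPairs.

(** * Outer SG points and pairs of common tangents *)

Section ConicFamilies.
Variable k : closedFieldType.

(** Applied with x = t, d a branch polynomial and c, r constants, it turns an equality of square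
    classes into the statement that t d is a square. *)
Lemma sq_quotient (K : fieldType) (v r c x d : K) : v != 0 -> c != 0 ->
  v ^+ 2 * (c * d) = r ^+ 2 * c * x -> (r * x / v) ^+ 2 = x * d.
Proof.
move=> v0 c0 e; have -> : d = (r ^+ 2 * c * x) / (v ^+ 2 * c).
  by rewrite -e; field; rewrite v0 c0.
by field; rewrite v0 c0.
Qed.

Lemma dim2_basis (U : {vspace 'rV[k]_3}) : \dim U = 2%N ->
  exists l1 l2, indep2 l1 l2 /\ U = (<[l1]> + <[l2]>)%VS.
Proof.
move=> dU; move: (vbasisP U) (etrans (size_tuple (vbasis U)) dU).
case: (tval (vbasis U)) => [|a [|b []]] // /andP[/eqP Us fr] _.
exists a, b; split; first exact/free_indep2.
by rewrite -Us span_cons span_seq1.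
Qed.

Hypothesis two0 : 2%:R != 0 :> k.
Variables (n : nat) (A : 'I_n -> 'M[k]_3).
Hypotheses (sA : forall i, (A i)^T = A i) (uA : forall i, A i \in unitmx).
Let F i := qform (A i).
Let B i := invmx (A i).

Lemma sg_of_isotropic (P : Defs.point k) p w1 w2 : val P = <[p]>%VS -> p != 0 ->
  indep2 w1 w2 -> pairing p w1 = 0 -> pairing p w2 = 0 ->
  (forall i, bil (B i) w1 w1 = 0) -> (forall i, bil (B i) w2 w2 = 0) ->
  outer_sg_points F P.
Proof.
move=> PE p0 ind e1 e2 i1 i2.
have out i := isotropic_outer (sA i) (uA i) p0 ind e1 e2 (i1 i) (i2 i).
split=> [|i /(vanishes_qform _ PE) v0]; last by have := out i; rewrite v0 eqxx.
have exC i := conic_irr_curve two0 (sA i) (uA i) (out i) e1 e2 ind (i1 i) (i2 i).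
pose C i := projT1 (cid2 (exC i)).
have CE i : Defs.form (C i) = F i by rewrite /C; case: cid2.
have CN i l : @coord_pi k (C i) (linform l) = 0 -> l = 0.
  by rewrite /C; case: cid2 => c h1 h2; exact: h2.
exists C; split=> // l1 l2 [fr onP].
have [f1 f2] := onP p (ltac:(by rewrite PE memv_line)).
have [a1 [b1 l1E]] := perp_span p0 ind e1 e2 (etrans (pairingC _ _) f1).
have [a2 [b2 l2E]] := perp_span p0 ind e1 e2 (etrans (pairingC _ _) f2).
have det : a1 * b2 - a2 * b1 != 0.
  apply/eqP => d0; have /free_indep2 ind12 := fr.
  have [] := ind12 b2 (- b1).
    rewrite l1E l2E !scalerDr !scalerA addrACA -!scalerDl.
    have -> : b2 * a1 + - b1 * a2 = 0 by rewrite -[RHS]d0; ring.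
    have -> : b2 * b1 + - b1 * b2 = 0 by ring.
    by rewrite !scale0r addr0.
  move=> b20 /eqP; rewrite oppr_eq0 => /eqP b10.
  have [] := ind12 a2 (- a1).
    rewrite l1E l2E !scalerDr !scalerA addrACA -!scalerDl b10 b20.
    have -> : a2 * a1 + - a1 * a2 = 0 by ring.
    by rewrite !mulr0 addr0 !scale0r addr0.
  move=> a20 /eqP; rewrite oppr_eq0 => /eqP a10.
  have [n1 _] := indep2_neq0 ind12.
  by move: n1; rewrite l1E a10 b10 !scale0r addr0 eqxx.
(* The polynomial in [conic_quad_gen] is the same for all i, which gives the isomorphisms. *)
have exphi i := conic_quad_gen two0 (sA i) (uA i) (out i) e1 e2 ind (i1 i) (i2 i)
  (CE i) (CN i) det.
pose phi i := projT1 (cid2 (exphi i)).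
have phiE i : is_pullback l1 l2 (phi i).
  by rewrite l1E l2E /phi; case: cid2.
have phiQ i : exists y, quad_gen (phi i)
    (tofrac ((a2 *: 'X + (- a1)%:P) * (b2 *: 'X + (- b1)%:P))) y.
  by rewrite /phi; case: cid2.
exists phi; split=> // [i|i j].
  by have [y yq] := phiQ i; exact: quad_galois (two_neq0_frac two0) yq.
by have [y yq] := phiQ i; have [z zq] := phiQ j; exact: quad_isom yq zq.
Qed.

Lemma isotropic_of_sg (i0 : 'I_n) (P : Defs.point k) p :
  val P = <[p]>%VS -> p != 0 -> outer_sg_points F P ->
  exists w1 w2, [/\ indep2 w1 w2, pairing p w1 = 0 /\ pairing p w2 = 0,
    forall i, bil (B i) w1 w1 = 0 & forall i, bil (B i) w2 w2 = 0].
Proof.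
move=> PE p0 [[C [CE sg]] outP].
have out i : bil (A i) p p != 0 by apply/eqP => /(vanishes_qform _ PE); exact: outP.
have sB i : (B i)^T = B i by rewrite trmx_inv sA.
have [l1 [l2 [ind12 pl1 pl2]]] : exists l1 l2, [/\ indep2 l1 l2, pairing p l1 = 0
    & pairing p l2 = 0].
  have [|l1 [l2 [ind UE]]] := @dim2_basis (orth (val P)).
    by rewrite dim_orth (eqP (valP P)).
  have orthp l : l \in orth (val P) -> pairing p l = 0.
    by rewrite mem_orth pairingC => /asboolP; apply; rewrite PE memv_line.
  exists l1, l2; split=> //; apply: orthp; rewrite UE.
    exact: (subvP (addvSl _ _) _ (memv_line _)).
  exact: (subvP (addvSr _ _) _ (memv_line _)).
have d12 := disc_neq0 (sA i0) (uA i0) pl1 pl2 ind12 (out i0).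
have [a1 [b1 [a2 [b2 [ind i1 i2]]]]] := isotropic_basis two0 (sB i0) ind12 d12.
set w1 := a1 *: l1 + b1 *: l2 in ind i1; set w2 := a2 *: l1 + b2 *: l2 in ind i2.
have e1 : pairing p w1 = 0.
  by rewrite pairingC pairingDl !pairingZl !(pairingC _ p) pl1 pl2 !mulr0 addr0.
have e2 : pairing p w2 = 0.
  by rewrite pairingC pairingDl !pairingZl !(pairingC _ p) pl1 pl2 !mulr0 addr0.
(* In the coordinate w1 / w2 the branch points of the reference conic are 0 and infinity. *)
have [|phi [phiE _ iso]] := sg w1 w2.
  split; first exact/free_indep2.
  move=> v; rewrite PE => /vlineP[c ->]; rewrite !(pairingC _ (c *: p)) !pairingZl.
  by rewrite e1 e2 mulr0.
suff zero i : bil (B i) w1 w1 = 0 /\ bil (B i) w2 w2 = 0.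
  by exists w1, w2; split=> // i; case: (zero i).
have [y0 y02 _] := conic_function_field (sA i0) (uA i0) (out i0) (CE i0) e1 e2 ind (phiE i0).
have [y y2 span] := conic_function_field (sA i) (uA i) (out i) (CE i) e1 e2 ind (phiE i).
have [h _ hE] := iso i0 i.
have d0 := disc_neq0 (sA i0) (uA i0) e1 e2 ind (out i0).
have b0 : bil (B i0) w1 w2 != 0.
  by move: d0; rewrite -/(B i0) i1 mul0r sub0r oppr_eq0 expf_eq0.
pose c0 := - (branch_coef (A i0) p w1 w2 * (2%:R * bil (B i0) w1 w2)).
have br0 : branch_coef (A i0) p w1 w2 *: branch_poly (A i0) w1 w2 = c0 *: 'X.
  rewrite /branch_poly -/(B i0) i1 i2 scale0r addr0 sub0r scalerN scalerA -scaleNr.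
  by [].
have c00 : c0 != 0.
  by rewrite oppr_eq0 !mulf_neq0 // oppr_eq0 mulf_neq0 // invr_eq0.
have X0 : c0 *: 'X != 0 :> {poly k} by rewrite scaler_eq0 (negPf c00) polyX_eq0.
(* The image of y0 in k(C_i) is a square root of c0 t, so c0 t and the discriminant of C_i differ by
   a square. *)
have [||v vE] := quad_square_class (two_neq0_frac two0) y2 (span (h y0))
    (t := tofrac (c0 *: 'X)) _ _.
- by rewrite expr2 -rmorphM -expr2 y02 hE br0.
- move=> r; apply: odd_degree_nonsquare => //.
  by rewrite size_scale // size_polyX.
set D := branch_poly (A i) w1 w2 in vE; set c := branch_coef _ _ _ _ in vE.
have d := disc_neq0 (sA i) (uA i) e1 e2 ind (out i).
have cN0 : c != 0 by rewrite oppr_eq0 mulf_neq0 // invr_eq0.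
have [r rE] := sqrt_exists (c0 / c).
have v0 : v != 0.
  apply: contraNneq X0 => v0; rewrite -tofrac_eq0 -vE v0.
  by rewrite expr0n mul0r.
pose e := tofrac (r%:P * 'X) / v.
(* Hence 'X * D has even degree and even multiplicity at 0. *)
have eE : e ^+ 2 = tofrac ('X * D).
  have tc0 : tofrac c%:P != 0 by rewrite tofrac_eq0 polyC_eq0.
  have c0E : tofrac c0%:P = tofrac r%:P ^+ 2 * tofrac c%:P :> {fraction {poly k}}.
    by rewrite -tofracXn -tofracM -polyC_exp -polyCM rE divfK.
  move: vE; rewrite -!mul_polyC !tofracM c0E => vE.
  by rewrite /e tofracM; exact: sq_quotient v0 tc0 vE.
have D0 : D.[0] = bil (B i) w1 w1.
  by rewrite /D /branch_poly -/(B i) !hornerD hornerN !hornerZ hornerXn hornerX hornerC expr0n !mulr0 subr0 add0r.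
(* If the constant coefficient of D is nonzero, 0 is a simple root of 'X * D; if the coefficient of
   t^2 is nonzero, 'X * D has degree three. *)
split; apply/eqP/negPn/negP => N0.
  have rD : ~~ root D 0 by rewrite rootE D0.
  apply: (odd_mup_nonsquare _ _ eE (r := 0)).
    by rewrite mulf_neq0 ?polyX_eq0 //; apply: contraNneq rD => ->; exact: root0.
  rewrite mupMl //.
  by have := mup_XsubCX 1 (0 : k) 0; rewrite expr1 eqxx subr0 => ->.
have sD : size D = 3%N.
  rewrite /D /branch_poly -addrA size_addl size_scale ?size_polyXn //.
  rewrite (leq_ltn_trans (size_polyD _ _)) // gtn_max size_polyN.
  rewrite (leq_ltn_trans (size_scale_leq _ _)) ?size_polyX //=.
  by rewrite (leq_ltn_trans (size_polyC_leq1 _)).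
have DN0 : D != 0 by rewrite -size_poly_eq0 sD.
apply: (odd_degree_nonsquare _ _ eE).
  by rewrite mulf_neq0 ?polyX_eq0.
by rewrite mulrC size_mulX // sD.
Qed.
End ConicFamilies.

(** * Common points of two conics *)

Section Pairs.
Variable T : eqType.
Implicit Types (s : seq T) (x y : T).

Fixpoint pairs s : seq (T * T) :=
  if s is x :: s' then [seq (x, y) | y <- s'] ++ pairs s' else [::].

Lemma size_pairs s : size (pairs s) = 'C(size s, 2).
Proof. by elim: s => //= x s IH; rewrite size_cat size_map IH binS bin1 addnC. Qed.

Lemma mem_pairs s x y : (x, y) \in pairs s -> x \in s /\ y \in s.
Proof.
elim: s => //= z s IH; rewrite mem_cat => /orP[/mapP[u us [-> ->]]|/IH[xs ys]].
  by rewrite !inE eqxx us orbT.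
by rewrite !inE xs ys !orbT.
Qed.

Lemma pairs_total s x y : x \in s -> y \in s -> x != y ->
  (x, y) \in pairs s \/ (y, x) \in pairs s.
Proof.
elim: s => //= z s IH; rewrite !inE !mem_cat.
move=> /orP[/eqP->|xs] /orP[/eqP->|ys]; rewrite ?eqxx // => xy.
- by left; apply/orP; left; apply/mapP; exists y.
- by right; apply/orP; left; apply/mapP; exists x.
- by have [] := IH xs ys xy => ->; [left|right]; rewrite orbT.
Qed.

Lemma pairs_neq s x y : uniq s -> (x, y) \in pairs s -> x != y.
Proof.
elim: s => //= z s IH /andP[zs us]; rewrite mem_cat => /orP[/mapP[u uin [-> ->]]|].
  by apply: contraNneq zs => ->.
exact: IH.
Qed.

Lemma pairs_asym s x y : uniq s -> (x, y) \in pairs s -> (y, x) \notin pairs s.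
Proof.
elim: s => //= z s IH /andP[zs us]; rewrite !mem_cat negb_or.
move=> /orP[/mapP[u uin [-> ->]]|xyp].
  apply/andP; split; first by apply/mapP => -[v vs [uz _]]; rewrite -uz uin in zs.
  by apply/negP => /mem_pairs[_ zin]; rewrite zin in zs.
rewrite IH // andbT; apply/mapP => -[v vs [yz _]].
by have [_] := mem_pairs xyp; rewrite yz (negPf zs).
Qed.

Lemma pairs_uniq s : uniq s -> uniq (pairs s).
Proof.
elim: s => //= z s IH /andP[zs us]; rewrite cat_uniq IH // andbT.
rewrite map_inj_uniq ?us /=; last by move=> ? ? [].
apply/hasPn => -[x y] xyp; apply/mapP => -[v vs [xz _]].
by have [] := mem_pairs xyp; rewrite xz (negPf zs).
Qed.

End Pairs.

(** A repetition-free list of elements of S of maximal length exhausts S. *)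
Lemma finite_of_bounded (T : choiceType) (S : set T) N :
  (forall s, uniq s -> (forall x, x \in s -> S x) -> (size s <= N)%N) ->
  exists2 s, uniq s & S = [set` s]%classic.
Proof.
move=> bnd.
pose Q m := `[< exists2 s, uniq s /\ size s = m & forall x, x \in s -> S x >].
have Q0 : exists m, Q m by exists 0%N; apply/asboolP; exists [::].
have QN m : Q m -> (m <= N)%N by move=> /asboolP[s [us <-]]; exact: bnd.
case: (ex_maxnP Q0 QN) => m /asboolP[s [us sm] sS] mx.
exists s => //; apply/seteqP; split=> x /=; last exact: sS.
move=> Sx; apply: contrapT => /negP xs.
have : (m.+1 <= m)%N.
  apply: mx; apply/asboolP; exists (x :: s); first by rewrite /= xs us sm.
  by move=> y; rewrite inE => /orP[/eqP->|/sS].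
by rewrite ltnn.
Qed.

Lemma card_uniq_seq (T : choiceType) (s : seq T) : uniq s ->
  ([set` s]%classic #= `I_(size s))%card.
Proof.
move=> us; apply/card_set_bijP; exists (index^~ s); split.
- by move=> x /= xs; rewrite index_mem.
- by move=> x y /[!inE] /= xs ys e; rewrite -(nth_index x xs) e nth_index.
- move=> i /= il; case: s us il => // x s us il.
  exists (nth x (x :: s) i); [exact: mem_nth|exact: index_uniq].
Qed.

(** * A smooth conic is determined by five points *)

Section FivePoints.
Variable k : closedFieldType.
Hypothesis two0 : 2%:R != 0 :> k.
Implicit Types (B : 'M[k]_3) (w : 'rV[k]_3).

Lemma perp_exists w1 w2 : indep2 w1 w2 ->
  exists p, [/\ p != 0, pairing p w1 = 0 & pairing p w2 = 0].
Proof.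
move=> /free_indep2 fr.
have d2 : \dim (<[w1]> + <[w2]>)%VS = 2%N.
  by move: fr; rewrite /free span_cons span_seq1 => /eqP.
have d1 : \dim (orth (<[w1]> + <[w2]>)%VS) == 1%N by rewrite dim_orth d2.
have [p p0 pE] := point_gen (exist (fun U => \dim U == 1%N) _ d1 : Defs.point k).
exists p; split=> //.
  have : p \in orth (<[w1]> + <[w2]>)%VS by rewrite [orth _]pE memv_line.
  by rewrite mem_orth => /asboolP; apply; exact: (subvP (addvSl _ _) _ (memv_line _)).
have : p \in orth (<[w1]> + <[w2]>)%VS by rewrite [orth _]pE memv_line.
by rewrite mem_orth => /asboolP; apply; exact: (subvP (addvSr _ _) _ (memv_line _)).
Qed.

(** By [isotropic_on_secant], an isotropic vector in the span of w1 and w2 is proportional to one of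
    them. *)
Lemma no_three_collinear B w1 w2 w3 : B^T = B -> B \in unitmx ->
  bil B w1 w1 = 0 -> bil B w2 w2 = 0 -> bil B w3 w3 = 0 ->
  indep2 w1 w2 -> indep2 w1 w3 -> indep2 w2 w3 -> indep3 w1 w2 w3.
Proof.
move=> sB uB i1 i2 i3 ind12 ind13 ind23.
have [p [p0 e1 e2]] := perp_exists ind12.
have b0 := isotropic_pair_neq0 sB uB p0 ind12 e1 e2 i1 i2.
move=> a b c e; suff c0 : c = 0.
  by move: e; rewrite c0 scale0r addr0 => /ind12[].
apply/eqP/negPn/negP => c0.
have w3E : w3 = (- (a / c)) *: w1 + (- (b / c)) *: w2.
  have -> : w3 = c^-1 *: (c *: w3) by rewrite scalerA mulVf // scale1r.
  have -> : c *: w3 = - (a *: w1 + b *: w2).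
    by apply/eqP; rewrite -addr_eq0 addrC e.
  by rewrite scalerN scalerDr !scalerA opprD -!scaleNr ![c^-1 * _]mulrC.
move: i3; rewrite w3E => /(isotropic_on_secant two0 sB b0 i1 i2)[] z0.
  have [_ /eqP] := ind23 (b / c) 1 (ltac:(by rewrite w3E z0 scale0r add0r scale1r scaleNr subrr)).
  by rewrite oner_eq0.
have [_ /eqP] := ind13 (a / c) 1 (ltac:(by rewrite w3E z0 scale0r addr0 scale1r scaleNr subrr)).
by rewrite oner_eq0.
Qed.

(* [b] and [c] are the values of two conics at the pairs of basis vectors, [x]
   and [y] the coordinates of two further common points. *)
Lemma five_points_coordinates (b1 b2 b3 c1 c2 c3 x1 x2 x3 y1 y2 y3 : k) :
  b1 != 0 -> x1 != 0 -> x2 != 0 -> x3 != 0 -> y1 != 0 -> y2 != 0 -> y3 != 0 ->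
  b1 * x1 * x2 + b2 * x1 * x3 + b3 * x2 * x3 = 0 ->
  b1 * y1 * y2 + b2 * y1 * y3 + b3 * y2 * y3 = 0 ->
  c1 * x1 * x2 + c2 * x1 * x3 + c3 * x2 * x3 = 0 ->
  c1 * y1 * y2 + c2 * y1 * y3 + c3 * y2 * y3 = 0 ->
  (c2 = c1 / b1 * b2 /\ c3 = c1 / b1 * b3) \/
  (y2 * x1 = x2 * y1 /\ y2 * x3 = x2 * y3).
Proof.
move=> b0 x10 x20 x30 y10 y20 y30 ebx eby ecx ecy.
(* The member c - (c1 / b1) b of the pencil is x3 (d2 x1 + d3 x2), a pair of lines. Both points
   avoid x3 = 0, so they lie on the other line unless d2 = d3 = 0. *)
set d2 := c2 - c1 / b1 * b2; set d3 := c3 - c1 / b1 * b3.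
have ex : d2 * x1 + d3 * x2 = 0.
  apply: (mulIf x30); rewrite mul0r -[RHS](subr0 0) -{1}ecx.
  by rewrite -[X in _ - X](mulr0 (c1 / b1)) -ebx /d2 /d3; field.
have ey : d2 * y1 + d3 * y2 = 0.
  apply: (mulIf y30); rewrite mul0r -[RHS](subr0 0) -{1}ecy.
  by rewrite -[X in _ - X](mulr0 (c1 / b1)) -eby /d2 /d3; field.
have [d20|d20] := eqVneq d2 0.
  left; move: ex; rewrite d20 mul0r add0r => /eqP.
  rewrite mulf_eq0 (negPf x20) orbF => /eqP d30.
  by split; apply/eqP; rewrite -subr_eq0; apply/eqP.
right; have e1 : y2 * x1 = x2 * y1.
  apply: (mulfI d20); apply/eqP; rewrite -subr_eq0; apply/eqP.
  transitivity (y2 * (d2 * x1 + d3 * x2) - x2 * (d2 * y1 + d3 * y2)); first by ring.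
  by rewrite ex ey !mulr0 subrr.
split=> //.
(* The equation of the first conic, solved for the third coordinate, transfers the equality of
   ratios to it. *)
set G := b2 * x1 + b3 * x2; set H := b2 * y1 + b3 * y2.
have hx : x3 * G = - (b1 * x1 * x2).
  by apply/eqP; rewrite -subr_eq0 -[X in _ == X]ebx; apply/eqP; rewrite /G; ring.
have hy : y3 * H = - (b1 * y1 * y2).
  by apply/eqP; rewrite -subr_eq0 -[X in _ == X]eby; apply/eqP; rewrite /H; ring.
have H0 : x2 * H != 0.
  rewrite mulf_neq0 //; apply/eqP => H0; move/eqP: hy.
  by rewrite H0 mulr0 eq_sym oppr_eq0 !mulf_eq0 (negPf b0) (negPf y10) (negPf y20).
have GH : y2 * G = x2 * H.
  transitivity (b2 * (y2 * x1) + b3 * (x2 * y2)); first by rewrite /G; ring.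
  by rewrite e1 /H; ring.
apply: (mulIf H0); rewrite -{1}GH.
transitivity (y2 ^+ 2 * (x3 * G)); first by ring.
transitivity (x2 ^+ 2 * (y3 * H)); last by ring.
rewrite hx hy; transitivity (- (b1 * x2 * y2) * (y2 * x1)); first by ring.
by rewrite e1; ring.
Qed.

(** In the basis w1, w2, w3 both forms keep only off-diagonal coefficients, and w4, w5 have nonzero
    coordinates since no three of the points are collinear. *)
Lemma five_points B B' w1 w2 w3 w4 w5 : B^T = B -> B'^T = B' ->
  B \in unitmx -> B' \in unitmx ->
  (forall w, w \in [:: w1; w2; w3; w4; w5] -> bil B w w = 0 /\ bil B' w w = 0) ->
  [/\ indep2 w1 w2, indep2 w1 w3, indep2 w1 w4 & indep2 w1 w5] ->
  [/\ indep2 w2 w3, indep2 w2 w4 & indep2 w2 w5] ->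
  [/\ indep2 w3 w4, indep2 w3 w5 & indep2 w4 w5] ->
  exists c, B' = c *: B.
Proof.
move=> sB sB' uB uB' iso [i12 i13 i14 i15] [i23 i24 i25] [i34 i35 i45].
have [z1 z1'] : bil B w1 w1 = 0 /\ bil B' w1 w1 = 0 by apply: iso; rewrite !inE eqxx.
have [z2 z2'] : bil B w2 w2 = 0 /\ bil B' w2 w2 = 0 by apply: iso; rewrite !inE eqxx ?orbT.
have [z3 z3'] : bil B w3 w3 = 0 /\ bil B' w3 w3 = 0 by apply: iso; rewrite !inE eqxx ?orbT.
have [z4 z4'] : bil B w4 w4 = 0 /\ bil B' w4 w4 = 0 by apply: iso; rewrite !inE eqxx ?orbT.
have [z5 z5'] : bil B w5 w5 = 0 /\ bil B' w5 w5 = 0 by apply: iso; rewrite !inE eqxx ?orbT.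
have [p [p0 pw1 pw2]] := perp_exists i12.
have b0 := isotropic_pair_neq0 sB uB p0 i12 pw1 pw2 z1 z2.
have [u1 [u2 [u3 [_ _ _ uE]]]] := dual_basis (no_three_collinear sB uB z1 z2 z3 i12 i13 i23).
have coord w : bil B w w = 0 -> indep2 w1 w -> indep2 w2 w -> indep2 w3 w ->
    [/\ pairing w u1 != 0, pairing w u2 != 0 & pairing w u3 != 0].
  move=> zw j1 j2 j3; split; apply/eqP => x0; have := uE w; rewrite x0 scale0r.
  - move=> e; have [|_ _ /eqP] := no_three_collinear sB uB z2 z3 zw i23 j2 j3 (a := pairing w u2) (b := pairing w u3) (c := -1).
      by rewrite scaleN1r {3}e add0r subrr.
    by rewrite oppr_eq0 oner_eq0.
  - move=> e; have [|_ _ /eqP] := no_three_collinear sB uB z1 z3 zw i13 j1 j3 (a := pairing w u1) (b := pairing w u3) (c := -1).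
      by rewrite scaleN1r {3}e addr0 subrr.
    by rewrite oppr_eq0 oner_eq0.
  - move=> e; have [|_ _ /eqP] := no_three_collinear sB uB z1 z2 zw i12 j1 j2 (a := pairing w u1) (b := pairing w u2) (c := -1).
      by rewrite scaleN1r {3}e addr0 subrr.
    by rewrite oppr_eq0 oner_eq0.
have [x1 x2 x3] := coord w4 z4 i14 i24 i34; have [y1 y2 y3] := coord w5 z5 i15 i25 i35.
have expand C w : C^T = C -> bil C w1 w1 = 0 -> bil C w2 w2 = 0 -> bil C w3 w3 = 0 ->
    bil C w w = 0 -> bil C w1 w2 * pairing w u1 * pairing w u2 +
     bil C w1 w3 * pairing w u1 * pairing w u3 + bil C w2 w3 * pairing w u2 * pairing w u3 = 0.
  move=> sC c1 c2 c3 cw; apply: (mulfI two0); rewrite mulr0 -[RHS]cw.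
  rewrite [in RHS](uE w) !(bilDl, bilDr) !(bilZl, bilZr) c1 c2 c3.
  rewrite [bil C w2 w1]bilC // [bil C w3 w1]bilC // [bil C w3 w2]bilC //.
  by ring.
have [[e2 e3]|[e1 e3]] := five_points_coordinates b0 x1 x2 x3 y1 y2 y3
  (expand B w4 sB z1 z2 z3 z4) (expand B w5 sB z1 z2 z3 z5)
  (expand B' w4 sB' z1' z2' z3' z4') (expand B' w5 sB' z1' z2' z3' z5').
  exists (bil B' w1 w2 / bil B w1 w2); set c := _ / _ in e2 e3 *.
  have e1 : bil B' w1 w2 = c * bil B w1 w2 by rewrite /c divfK.
  have eB u v : bil B' u v = c * bil B u v.
    rewrite (uE u) (uE v) !(bilDl, bilDr) !(bilZl, bilZr).
    rewrite z1 z2 z3 z1' z2' z3' [bil _ w2 w1]bilC // [bil _ w3 w1]bilC //.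
    rewrite [bil _ w3 w2]bilC // [bil B w2 w1]bilC // [bil B w3 w1]bilC //.
    rewrite [bil B w3 w2]bilC // e1 e2 e3.
    by ring.
  apply/row_matrixP => i; apply/eqP; rewrite linearZ /= -subr_eq0 -scaleNr; apply/eqP.
  apply: pairing_nondeg => v; rewrite pairingDl pairingZl !rowE -!bil_pairing eB.
  by rewrite mulNr subrr.
(* In the other case w4 and w5 are proportional, against their independence. *)
have [|/eqP] := i45 (pairing w5 u2) (- pairing w4 u2); last by rewrite (negPf y2).
have := uE w4; have := uE w5; move: e1 e3.
set a1 := pairing w4 u1; set a2 := pairing w4 u2; set a3 := pairing w4 u3.
set b1 := pairing w5 u1; set b2 := pairing w5 u2; set b3 := pairing w5 u3.
move=> e1 e3 -> ->; rewrite !scalerDr !scalerA e1 e3 !mulNr (mulrC b2 a2) !scaleNr.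
by rewrite -!opprD subrr.
Qed.
End FivePoints.

(** * Secants through the common points and their number *)

Section DualConicsIntersection.
Variable k : closedFieldType.
Hypothesis two0 : 2%:R != 0 :> k.
Implicit Types (p q r P T : Defs.point k) (L : line k).

Lemma orthK (U : {vspace 'rV[k]_3}) : orth (orth U) = U.
Proof.
apply/esym/eqP; rewrite eqEdim !dim_orth; apply/andP; split.
  apply/subvP => u uU; rewrite mem_orth; apply/asboolP => x.
  by rewrite mem_orth pairingC => /asboolP; exact.
by rewrite subKn // (leq_trans (dimvS (subvf U))) // dimvf dim_matrix.
Qed.

Lemma coef_point_inj : injective (@coef_point k).
Proof.
move=> L L' /(congr1 val) /= e; apply: val_inj.
by rewrite -[LHS]orthK e orthK.
Qed.

Lemma indep2_points p q u v : val p = <[u]>%VS -> val q = <[v]>%VS ->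
  p != q -> indep2 u v.
Proof.
move=> pE qE pq a b e; suff b0 : b = 0.
  split=> //; move: e; rewrite b0 scale0r addr0 => /eqP.
  rewrite scaler_eq0 => /orP[/eqP//|/eqP u0].
  by have := valP p; rewrite /= pE u0 dim_vline eqxx.
apply/eqP/negPn/negP => b0; case/eqP: pq; apply/esym/val_inj/eqP.
rewrite eqEdim (eqP (valP p)) (eqP (valP q)) leqnn andbT qE pE -memvE.
apply/vlineP; exists (- (a / b)).
have -> : v = b^-1 *: (b *: v) by rewrite scalerA mulVf // scale1r.
have -> : b *: v = - (a *: u) by apply/eqP; rewrite -addr_eq0 addrC e.
by rewrite scalerN scalerA mulrC scaleNr.
Qed.

Lemma join_line u v : indep2 u v -> exists L, val L = (<[u]> + <[v]>)%VS.
Proof.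
move=> /free_indep2; rewrite /free span_cons span_seq1 => d2.
by exists (exist (fun U => \dim U == 2%N) _ d2).
Qed.

Variables (n : nat) (A : 'I_n -> 'M[k]_3).
Hypotheses (sA : forall i, (A i)^T = A i) (uA : forall i, A i \in unitmx).
Let F i := qform (A i).
Let B i := invmx (A i).
Let sB i : (B i)^T = B i. Proof. by rewrite /B trmx_inv sA. Qed.
Let uB i : B i \in unitmx. Proof. by rewrite unitmx_inv. Qed.
Variables (i0 i1 : 'I_n).
Hypothesis distinct : zero_locus (F i0) <> zero_locus (F i1).

Let common T u : val T = <[u]>%VS -> common_tangents F T <-> forall i, bil (B i) u u = 0.
Proof.
move=> TE; split=> h i.
  by apply/(vanishes_qform _ TE)/dual_curveP => //; exact: h.
by apply/dual_curveP => //; apply/(vanishes_qform _ TE)/h.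
Qed.

Lemma secant_lines_bij : set_bij (secant_lines F) (outer_sg_points F) (@coef_point k).
Proof.
split.
- move=> L [p [q [cp cq pq LE]]].
  have [u u0 pE] := point_gen p; have [v v0 qE] := point_gen q.
  have [w w0 PE] := point_gen (coef_point L).
  have perp x : x \in val L -> pairing w x = 0.
    by apply: (mem_coef_point L w).1; rewrite PE memv_line.
  apply: (sg_of_isotropic two0 sA uA PE w0 (indep2_points pE qE pq)).
  + by apply: perp; rewrite LE; apply: (subvP (addvSl _ _)); rewrite pE memv_line.
  + by apply: perp; rewrite LE; apply: (subvP (addvSr _ _)); rewrite qE memv_line.
  + exact/(common pE).
  + exact/(common qE).
- by move=> L L' _ _; exact: coef_point_inj.
- move=> P oP; have [w w0 PE] := point_gen P.
  have [w1 [w2 [ind [e1 e2] z1 z2]]] := isotropic_of_sg two0 sA uA i0 PE w0 oP.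
  have [n1 n2] := indep2_neq0 ind.
  have [p pE] := span_point n1; have [q qE] := span_point n2.
  have [L LE] := join_line ind; exists L.
    exists p, q; split; [exact/(common pE)|exact/(common qE)| |by rewrite pE qE].
    apply/eqP => pq; have : w2 \in <[w1]>%VS by rewrite -pE pq qE memv_line.
    case/vlineP => c w2E; have [|_ /eqP] := ind c (-1).
      by rewrite w2E scaleN1r subrr.
    by rewrite oppr_eq0 oner_eq0.
  apply/esym/val_inj/eqP; rewrite eqEdim /= dim_orth LE PE.
  have -> : \dim (<[w1]> + <[w2]>)%VS = 2%N by rewrite -LE (eqP (valP L)).
  rewrite dim_vline w0 andbT -memvE mem_orth; apply/asboolP => x.
  move=> /memv_addP[_ /vlineP[a ->] [_ /vlineP[b ->] ->]].
  by rewrite pairingC pairingDl !pairingZl !(pairingC _ w) e1 e2 !mulr0 addr0.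
Qed.

Lemma common_tangents_bound (s : seq (Defs.point k)) : uniq s ->
  (forall x, x \in s -> common_tangents F x) -> (size s <= 4)%N.
Proof.
case: s => [|p1 [|p2 [|p3 [|p4 [|p5 s]]]]] // us sC; exfalso.
have [w1 _ E1] := point_gen p1; have [w2 _ E2] := point_gen p2.
have [w3 _ E3] := point_gen p3; have [w4 _ E4] := point_gen p4.
have [w5 _ E5] := point_gen p5.
have iso p w : val p = <[w]>%VS -> p \in [:: p1, p2, p3, p4, p5 & s] ->
    bil (B i0) w w = 0 /\ bil (B i1) w w = 0.
  by move=> pE /sC /(common pE) h.
move: us; rewrite /= !inE !negb_or -!andbA.
move=> /and5P[d12 d13 d14 d15 /andP[_ /and5P[d23 d24 d25 _ /and4P[d34 d35 _ /andP[d45 _]]]]].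
have [||||c BE] := five_points two0 (sB i0) (sB i1) (uB i0) (uB i1)
    (w1 := w1) (w2 := w2) (w3 := w3) (w4 := w4) (w5 := w5).
- move=> w; rewrite !inE => /orP[/eqP->|/orP[/eqP->|/orP[/eqP->|/orP[/eqP->|/eqP->]]]].
  + exact: (iso _ _ E1 (@mem_nth _ p1 [:: p1, p2, p3, p4, p5 & s] 0 isT)).
  + exact: (iso _ _ E2 (@mem_nth _ p1 [:: p1, p2, p3, p4, p5 & s] 1 isT)).
  + exact: (iso _ _ E3 (@mem_nth _ p1 [:: p1, p2, p3, p4, p5 & s] 2 isT)).
  + exact: (iso _ _ E4 (@mem_nth _ p1 [:: p1, p2, p3, p4, p5 & s] 3 isT)).
  + exact: (iso _ _ E5 (@mem_nth _ p1 [:: p1, p2, p3, p4, p5 & s] 4 isT)).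
- by split; [exact: indep2_points E1 E2 d12|exact: indep2_points E1 E3 d13
    |exact: indep2_points E1 E4 d14|exact: indep2_points E1 E5 d15].
- by split; [exact: indep2_points E2 E3 d23|exact: indep2_points E2 E4 d24
    |exact: indep2_points E2 E5 d25].
- by split; [exact: indep2_points E3 E4 d34|exact: indep2_points E3 E5 d35
    |exact: indep2_points E4 E5 d45].
(* Multiply [B i1 = c *: B i0] by [A i1] on the left and [A i0] on the right. *)
have AE : A i0 = c *: A i1.
  rewrite -[LHS]mul1mx -(mulmxV (uA i1)) -/(B i1) BE -mulmxA -scalemxAl mulVmx //.
  by rewrite -scalemxAr mulmx1.
have c0 : c != 0.
  by apply: contraTneq (uA i0) => c0; rewrite AE c0 scale0r unitmxE det0 unitr0.
apply: distinct; apply/seteqP; split=> P; have [w _ PE] := point_gen P.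
  move/(vanishes_qform _ PE) => h; apply/(vanishes_qform _ PE); move: h.
  by rewrite AE /bil -scalemxAr -scalemxAl mxE => /eqP; rewrite mulf_eq0 (negPf c0) => /eqP.
move/(vanishes_qform _ PE) => h; apply/(vanishes_qform _ PE).
by rewrite AE /bil -scalemxAr -scalemxAl mxE [X in c * X]h mulr0.
Qed.

Lemma secant_third_point p q r : common_tangents F p -> common_tangents F q ->
  common_tangents F r -> p != q -> (val r <= val p + val q)%VS -> r = p \/ r = q.
Proof.
have [u u0 pE] := point_gen p; have [v v0 qE] := point_gen q.
have [w w0 rE] := point_gen r.
move=> /(common pE)/(_ i0) cp /(common qE)/(_ i0) cq /(common rE)/(_ i0) cr pq.
have ind := indep2_points pE qE pq; have [x [x0 e1 e2]] := perp_exists ind.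
have b0 := isotropic_pair_neq0 (sB i0) (uB i0) x0 ind e1 e2 cp cq.
rewrite rE pE qE -memvE => /memv_addP[_ /vlineP[a ->] [_ /vlineP[b ->] wE]].
have line_eq (y z : 'rV[k]_3) c : y != 0 -> y = c *: z -> <[y]>%VS = <[z]>%VS.
  move=> y0 yE; apply/eqP; rewrite eqEdim -memvE yE memvZ ?memv_line //=.
  by rewrite -yE !dim_vline y0 leq_b1.
move: cr; rewrite wE => /(isotropic_on_secant two0 (sB i0) b0 cp cq)[] z.
  right; apply: val_inj; rewrite rE qE; apply: line_eq w0 _.
  by rewrite wE z scale0r add0r.
left; apply: val_inj; rewrite rE pE; apply: line_eq w0 _.
by rewrite wE z scale0r addr0.
Qed.

Lemma secant_pair_inj p q p' q' :
  common_tangents F p -> common_tangents F q ->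
  common_tangents F p' -> common_tangents F q' -> p != q -> p' != q' ->
  (val p + val q)%VS = (val p' + val q')%VS -> (p, q) = (p', q') \/ (p, q) = (q', p').
Proof.
move=> cp cq cp' cq' pq pq' e.
have [|pE|pE] := secant_third_point cp' cq' cp pq'; first by rewrite -e addvSl.
  have [|qE|qE] := secant_third_point cp' cq' cq pq'; first by rewrite -e addvSr.
    by rewrite pE qE eqxx in pq.
  by rewrite pE qE; left.
have [|qE|qE] := secant_third_point cp' cq' cq pq'; first by rewrite -e addvSr.
  by rewrite pE qE; right.
by rewrite pE qE eqxx in pq.
Qed.

(** By [secant_pair_inj] a secant determines its two common points, so secants correspond to
    unordered pairs. *)
Lemma secant_lines_count (s : seq (Defs.point k)) : uniq s ->
  common_tangents F = [set` s]%classic ->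
  (outer_sg_points F #= `I_('C(size s, 2)))%card.
Proof.
move=> us TE.
have inT x : x \in s -> common_tangents F x by rewrite TE.
(* The sum of two points is a line only if they differ, so the list of lines is specified through
   the underlying subspaces. *)
have [ls lsE] : exists ls : seq (line k),
    map val ls = [seq (val x.1 + val x.2)%VS | x <- pairs s].
  have := fun x y => @pairs_neq _ s x y us; elim: (pairs s) => [|[p q] ps IH] neq.
    by exists [::].
  have [|ls lsE] := IH; first by move=> x y xy; apply: neq; rewrite inE xy orbT.
  have [u _ pE] := point_gen p; have [v _ qE] := point_gen q.
  have [|L LE] := @join_line u v.
    by apply: indep2_points pE qE _; apply: neq; rewrite inE eqxx.
  by exists (L :: ls); rewrite /= lsE LE pE qE.
have sz : size ls = 'C(size s, 2).
  by rewrite -size_pairs -(size_map val) lsE size_map.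
have uls : uniq ls.
  rewrite -(map_inj_uniq val_inj) lsE map_inj_in_uniq; first exact: pairs_uniq.
  move=> [p q] [p' q'] /= h h' e.
  have [/inT cp /inT cq] := mem_pairs h; have [/inT cp' /inT cq'] := mem_pairs h'.
  have [//|[pE qE]] := secant_pair_inj cp cq cp' cq' (pairs_neq us h) (pairs_neq us h') e.
  by have := pairs_asym us h'; rewrite -pE -qE h.
have memls L : L \in ls = (val L \in [seq (val x.1 + val x.2)%VS | x <- pairs s]).
  by rewrite -lsE mem_map //; exact: val_inj.
have secE : secant_lines F = [set` ls]%classic.
  apply/seteqP; split=> L /=.
    move=> [p [q [cp cq pq LE]]]; rewrite memls LE.
    rewrite TE /= in cp cq.
    have [h|h] := pairs_total cp cq pq; apply/mapP; first by exists (p, q).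
    by exists (q, p) => //=; rewrite addvC.
  rewrite memls => /mapP[[p q] h LE]; have [/inT cp /inT cq] := mem_pairs h.
  by exists p, q; split=> //; exact: pairs_neq us h.
have [fS fI fO] := secant_lines_bij.
have -> : outer_sg_points F = [set` map (@coef_point k) ls]%classic.
  apply/seteqP; split=> P /=.
    by move/fO => -[L]; rewrite secE /= => Lls <-; exact: map_f.
  by move=> /mapP[L Lls ->]; apply: fS; rewrite secE.
rewrite -sz -(size_map (@coef_point k)); apply: card_uniq_seq.
by rewrite map_inj_uniq //; exact: coef_point_inj.
Qed.

End DualConicsIntersection.

Theorem theorem8 (k : closedFieldType) (char0 : [pchar k]%R =i pred0)
    (n : nat) (n2 : (2 <= n)%N) (F : 'I_n -> {mpoly k[3]})
    (deg2 : forall i, curve_equation 2 (F i))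
    (smooth : forall i, nonsingular (F i))
    (distinct : forall i j, i != j -> zero_locus (F i) <> zero_locus (F j)) :
  set_bij (secant_lines F) (outer_sg_points F) (@coef_point k) /\
  exists m : nat, common_tangents F #= `I_m /\
    [\/ (m = 0%N \/ m = 1%N) /\ outer_sg_points F #= `I_0,
        m = 2%N /\ outer_sg_points F #= `I_1,
        m = 3%N /\ outer_sg_points F #= `I_3
      | m = 4%N /\ outer_sg_points F #= `I_6].
Proof.
have two0 : 2%:R != 0 :> k.
  by apply/negP => h2; have := char0 2%N; rewrite !inE /= h2.
have exA i := qform_exists two0 (deg2 i).2.
pose A i := projT1 (cid2 (exA i)).
have sA i : (A i)^T = A i by rewrite /A; case: cid2.
have FE : F = fun i => qform (A i).
  by apply/funext => i; rewrite /A; case: cid2.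
rewrite FE in smooth distinct *.
have uA i : A i \in unitmx by apply: nonsingular_unit => //; exact: smooth.
pose i0 : 'I_n := Ordinal (ltnW n2); pose i1 : 'I_n := Ordinal n2.
have d01 := distinct i0 i1 isT.
split; first exact: (secant_lines_bij two0 sA uA i0).
have [s us sE] := finite_of_bounded (common_tangents_bound two0 sA uA d01).
exists (size s); split; first by rewrite sE; exact: card_uniq_seq.
have := secant_lines_count two0 sA uA i0 us sE.
have : (size s <= 4)%N.
  by apply: (common_tangents_bound two0 sA uA d01) => // x xs; rewrite sE.
(* The binomials 'C(m, 2) for m = 0, ..., 4 are 0, 0, 1, 3, 6. *)
case: (size s) => [|[|[|[|[|//]]]]] _ cardE.
- by apply: Or41; split; [left|].
- by apply: Or41; split; [right|].
- by apply: Or42.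
- by apply: Or43.
- by apply: Or44.
Qed.
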